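(* Let $\Bbbk$ be a field, $R=\Bbbk[x_1,\dots,x_n]$, $m\ge1$ an integer, and $\mathfrak f\in R$ a nonzero form of degree $e$ with $\mathfrak f\notin(x_1^m,\dots,x_n^m)$. Put $s=n(m-1)-e$ and $I=(x_1^m,\dots,x_n^m):\mathfrak f$. The following are equivalent: (i) $I$ is a codimension $n$ Gorenstein ideal generated by forms of a single degree and having a linear resolution (i.e., for some $d$, a minimal graded free resolution $0\to R(-2d-n+2)\to R(-d-n+2)^{b_{n-1}}\to\cdots\to R(-d-1)^{b_2}\to R(-d)^{b_1}\to R$); (ii) $s$ is even and $\mathrm{rank}\,\mathcal M_{e,s/2,m}=\binom{s/2+n-1}{n-1}$; (iii) $s$ is even and $P_{\mathfrak f}$ lies in the Zariski open set $\mathbb P^{\binom{e+n-1}{n-1}-1}\setminus V(I_k(\mathcal{MG}_{e,s/2,m}))$, where $k=\binom{s/2+n-1}{n-1}$. Moreover, in this case $I$ is generated in degree $s/2+1$.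
   Context: $\mathcal M_{e,e',m}$: for $\mathfrak f=\sum_{|\alpha|=e}a_\alpha\mathbf x^\alpha$, the matrix with rows indexed by $\gamma\in\mathbb N^n$, $|\gamma|=e+e'$, all $\gamma_i\le m-1$, columns indexed by $\beta\in\mathbb N^n$, $|\beta|=e'$, and $(\gamma,\beta)$ entry $a_{\gamma-\beta}$ if $\gamma-\beta\in\mathbb N^n$, $0$ otherwise. $P_{\mathfrak f}=(a_\alpha)_{|\alpha|=e}\in\mathbb P^{\binom{e+n-1}{n-1}-1}$ is the coefficient point of $\mathfrak f$, with homogeneous coordinates $Y_\alpha$, $|\alpha|=e$. $\mathcal{MG}_{e,e',m}$ is the matrix obtained from $\mathcal M_{e,e',m}$ by replacing each $a_\alpha$ by $Y_\alpha$, and $I_k(\cdot)$ is its ideal of $k\times k$ minors.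
   Formalization: The formal theorem assumes n ≥ 2; for n = 1 the claim fails, e.g. m = 2, f = 1 gives I = (x²), Gorenstein of codimension 1 with a linear resolution although s = 1 is odd, and for m = 3, f = 1, I = (x³) is not generated in degree s/2+1 = 2. *)

(* Defs.v *)
From HB Require Import structures.
From mathcomp Require Import all_boot all_algebra.
From mathcomp Require Import mpoly.
Set Implicit Arguments. Unset Strict Implicit. Unset Printing Implicit Defensive.
Import GRing.Theory.
Local Open Scope ring_scope.

Section Defs.
Variables (k : fieldType) (n : nat).
Local Notation R := {mpoly k[n]}.

Definition in_powers_ideal (m : nat) (p : R) : Prop :=
  exists c : 'I_n -> R, p = \sum_(i < n) c i * 'X_i ^+ m.

Definition in_colon (m : nat) (f p : R) : Prop := in_powers_ideal m (p * f).

Definition expT (e : nat) := {a : {ffun 'I_n -> 'I_e.+1} | \sum_(i < n) (a i : nat) == e}%N.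
Definition rowT (m t : nat) := {g : {ffun 'I_n -> 'I_m} | \sum_(i < n) (g i : nat) == t}%N.

Definition mono_of (e : nat) (a : expT e) : 'X_{1..n} := [multinom (val a i : nat) | i < n].

(* the matrix with rows gamma (|gamma| = e+e', gamma_i <= m-1), columns
   beta (|beta| = e'), and (gamma,beta) entry  Y (gamma - beta)  if
   gamma - beta is in N^n (then |gamma-beta| = e), 0 otherwise *)
Definition cat_mx (T : nzRingType) (e e' m : nat) (Y : expT e -> T)
  : 'M[T]_(#|{: rowT m (e + e')}|, #|{: expT e'}|) :=
  \matrix_(i < #|{: rowT m (e + e')}|, j < #|{: expT e'}|)
    let g := val (@enum_val _ {: rowT m (e + e')} i) in
    let b := val (@enum_val _ {: expT e'} j) in
    match [pick a : expT e | [forall l : 'I_n, (val a l : nat) + (b l : nat) == (g l : nat)]%N] with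
    | Some a => Y a
    | None => 0
    end.

Definition coef_pt (e : nat) (f : R) (a : expT e) : k := f@_(mono_of a).

Definition Mmat (e e' m : nat) (f : R) := cat_mx e' m (coef_pt (e := e) f).

Definition MGmat (e e' m : nat) :
  'M[{mpoly k[#|{: expT e}|]}]_(#|{: rowT m (e + e')}|, #|{: expT e'}|) :=
  cat_mx e' m (fun a : expT e => 'X_(enum_rank a)).

Definition outside_minors_locus (N r c kk : nat) (A : 'M[{mpoly k[N]}]_(r, c))
  (P : 'I_N -> k) : Prop :=
  exists (rs : 'I_kk -> 'I_r) (cs : 'I_kk -> 'I_c), (\det (mxsub rs cs A)).@[P] != 0.

(* degree of the entries of the i-th map (F_{i+1} -> F_i) in the resolution
   0 -> R(-2d-n+2) -> R(-d-n+2)^{b_{n-1}} -> ... -> R(-d-1)^{b_2} -> R(-d)^{b_1} -> R *)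
Definition lin_res_deg (d i : nat) : nat :=
  if (i == 0)%N then d else if (i == n.-1)%N then d else 1%N.

(* The ideal {p | Imem p} of R has a minimal graded free resolution of R/I
   of the shape 0 -> R(-2d-n+2) -> R(-d-n+2)^{b_{n-1}} -> ... -> R(-d)^{b_1} -> R.
   F_i = R^{b i}; phi i : F_{i+1} -> F_i is a (b i) x (b (i+1)) matrix acting on
   column vectors; graded of degree 0 for the given twists means its entries are
   forms of degree lin_res_deg d i; minimality means all entries lie in
   (x_1,...,x_n), i.e. have zero constant term. *)
Definition has_linear_gor_resolution (Imem : R -> Prop) (d : nat) : Prop :=
  exists (b : nat -> nat) (phi : forall i : nat, 'M[R]_(b i, b i.+1)),
  [/\ b 0%N = 1%N /\ b n = 1%N,
      (forall i, (i < n)%N -> forall r c,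
          phi i r c \is (lin_res_deg d i).-homog /\ (phi i r c)@_[multinom 0%N | l < n] = 0),
      (forall p : R, Imem p <-> exists w : 'cV[R]_(b 1%N),
          forall r : 'I_(b 0%N), p = (phi 0%N *m w) r ord0),
      (forall i, (i.+1 < n)%N -> forall v : 'cV[R]_(b i.+1),
          phi i *m v = 0 <-> exists w : 'cV[R]_(b i.+2), v = phi i.+1 *m w)
    & (forall v : 'cV[R]_(b n.-1.+1), phi n.-1 *m v = 0 -> v = 0)].

Definition generated_in_degree (Imem : R -> Prop) (t : nat) : Prop :=
  exists (r : nat) (g : 'I_r -> R),
    (forall j, g j \is t.-homog) /\
    (forall p : R, Imem p <-> exists c : 'I_r -> R, p = \sum_(j < r) c j * g j).

End Defs.

(* Main.v *)
(* Let [lam p] be the coefficient of [(x_1 ... x_n)^(m-1)] in [p f]. A polynomial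
   lies in the colon ideal I exactly when [lam] kills all its multiples, so A = R/I
   is Gorenstein with socle degree s, and the rank condition on the matrix says
   that s = 2t and that I has no form of degree t.
   If so, the Koszul homology of I lives in one degree per homological degree:
   below because A agrees with R up to degree t, above because the Koszul complex
   of A is dual to itself through the pairing [lam (p q)]. Passing to the syzygies
   on minimal generators shifts Koszul homology by one, so each syzygy module is
   generated in a single degree and the resolution is linear until the last step.
   Conversely, the n-th difference of the Hilbert function of A is read off both
   from the socle degree and from the twists of a resolution; comparing the top
   terms gives s = 2d - 2 (and also that the last Betti number is 1). *)

From Stdlib Require Import Classical ClassicalEpsilon.
Require Import Defs.
From HB Require Import structures.
From mathcomp Require Import all_boot all_algebra.
From mathcomp Require Import mpoly.
From mathcomp Require Import zify ring.
Set Implicit Arguments. Unset Strict Implicit. Unset Printing Implicit Defensive.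
Import GRing.Theory.
Local Open Scope ring_scope.

(** * Forms and shifted degrees *)

(** Homology never appears as a module: [koszul_van] says that cycles of one degree bound, and
    connecting maps become chases of explicit chains. Evenness of s enters through a count. If I has
    no form of degree at most t, cycles of I bound in degrees at most t, and by duality in degrees
    at least s-t+2. This leaves s-2t+1 degrees, a single one exactly when s = 2t. The last homology
    is outside the range of the duality argument: there a cycle comes from a socle element of A, so
    the exceptional degree is s+1 = 2t+1. Measured against generators of degree t+1, it becomes t+1,
    the degree of the entries of the last map. *)

Section ShiftedDegree.
Variables (k : fieldType) (n : nat).
Local Notation R := {mpoly k[n]}.

Lemma mcoeffMXE (p : R) (m u : 'X_{1..n}) :
  (p * 'X_[m])@_u = if (m <= u)%MM then p@_(u - m)%MM else 0.
Proof.
case: ifP => [le_mu | nle_mu].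
  by rewrite -[in LHS](submK le_mu) addmC mcoeffMX.
apply/memN_msupp_eq0; rewrite (perm_mem (msuppMX p m)).
by apply/mapP => -[v _ def_u]; rewrite def_u lem_addr in nle_mu.
Qed.

Lemma mcoeff_pihomog (d : nat) (p : R) (u : 'X_{1..n}) :
  (pihomog mdeg d p)@_u = if mdeg u == d then p@_u else 0.
Proof.
rewrite pihomogE raddf_sum /=; case: ifP => [/eqP du | ndu]; last first.
  apply: big1 => m /eqP dm; rewrite mcoeffZ mcoeffX.
  case: eqP => [mu | _]; last by rewrite mulr0.
  by rewrite -mu dm eqxx in ndu.
rewrite [in RHS](mpolyE p) raddf_sum /= [RHS](bigID (fun m => mdeg m == d)) /=.
rewrite [X in _ + X]big1 ?addr0 // => m ndm.
rewrite mcoeffZ mcoeffX; case: eqP => [mu | _]; last by rewrite mulr0.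
by rewrite mu du eqxx in ndm.
Qed.

(* Degrees are shifted by one: index [a] stands for degree [a - 1], index [0]
   for the zero space.  Truncated subtraction of indices is then exactly the
   behaviour of the twists of a graded free module. *)
Definition scomp (a : nat) (p : R) : R := if a is b.+1 then pihomog mdeg b p else 0.

Lemma mcoeff_scomp a (p : R) u :
  (scomp a p)@_u = if (mdeg u).+1 == a then p@_u else 0.
Proof. by case: a => [|a] /=; rewrite ?mcoeff0 // mcoeff_pihomog eqSS. Qed.

Fact scomp_is_linear a : linear (scomp a).
Proof.
move=> c p q; apply/mpolyP => u; rewrite !(mcoeffD, mcoeffZ, mcoeff_scomp).
by case: ifP; rewrite ?mulr0 ?addr0.
Qed.
HB.instance Definition _ a := GRing.isLinear.Build k R R _ (scomp a) (scomp_is_linear a).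

Definition shomog (a : nat) (p : R) : Prop := scomp a p = p.

Lemma shomogP a p : shomog a p <-> (forall u, (mdeg u).+1 <> a -> p@_u = 0).
Proof.
split=> [<- u /eqP/negPf ne | h]; first by rewrite mcoeff_scomp ne.
by apply/mpolyP => u; rewrite mcoeff_scomp; case: eqP => // /h.
Qed.

Lemma shomogE d (p : R) : shomog d.+1 p <-> p \is d.-homog.
Proof. by rewrite homog_piE; split=> [h | /eqP]; first apply/eqP. Qed.

Lemma shomog_scomp a p : shomog a (scomp a p).
Proof. by apply/shomogP => u /eqP/negPf ne; rewrite mcoeff_scomp ne. Qed.

Lemma shomog_eq0 p : shomog 0 p -> p = 0.
Proof. by move=> <-. Qed.

Lemma shomog0 a : shomog a 0.
Proof. by rewrite /shomog linear0. Qed.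

Lemma shomogD a p q : shomog a p -> shomog a q -> shomog a (p + q).
Proof. by rewrite /shomog linearD /= => -> ->. Qed.

Lemma shomogN a p : shomog a p -> shomog a (- p).
Proof. by rewrite /shomog linearN /= => ->. Qed.

Lemma shomogZ a c p : shomog a p -> shomog a (c *: p).
Proof. by rewrite /shomog linearZ /= => ->. Qed.

Lemma shomog_sum a (I : Type) (r : seq I) (P : pred I) (F : I -> R) :
  (forall i, P i -> shomog a (F i)) -> shomog a (\sum_(i <- r | P i) F i).
Proof. by move=> h; apply: big_ind => //; [exact: shomog0 | exact: shomogD]. Qed.

Lemma scomp_ne a b p : shomog b p -> a <> b -> scomp a p = 0.
Proof.
move=> /shomogP h ne; apply/mpolyP => u; rewrite mcoeff_scomp mcoeff0.
by case: eqP => // e; apply: h => e2; apply: ne; rewrite -e -e2.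
Qed.

Lemma scomp_sum (p : R) : exists K, p = \sum_(a < K) scomp a p.
Proof.
exists (msize p).+1; rewrite big_ord_recl /= add0r.
exact: (@pihomog_partitionE n k mdeg (msize p) p).
Qed.

(** Truncation of [a - d] gives the right answer: for [a <= d] the product has no part of index [a],
    and [scomp 0] is zero. *)
Lemma scompM d a (x p : R) : x \is d.-homog ->
  scomp a (x * p) = x * scomp (a - d) p.
Proof.
move=> hx; have [K defp] := scomp_sum p.
have hxp c : shomog (c + d) (x * scomp c p).
  case: c => [|c]; first by rewrite mulr0; apply: shomog0.
  by rewrite addSn addnC; apply/shomogE/dhomogM/shomogE/shomog_scomp.
have [->|a_gt0] := posnP a; first by rewrite /= mulr0.
have [le_ad | lt_da] := leqP a d.
  move: (le_ad); rewrite -subn_eq0 => /eqP ->; rewrite mulr0 {1}defp mulr_sumr linear_sum big1 // => c _.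
  case: (nat_of_ord c) => [|c']; first by rewrite mulr0 linear0.
  by apply: scomp_ne (hxp _) _; lia.
have -> : x * scomp (a - d) p = scomp a (x * scomp (a - d) p).
  by have := hxp (a - d)%N; rewrite subnK // ltnW.
rewrite {1}defp mulr_sumr linear_sum /=.
have [lt_aK | le_Ka] := ltnP (a - d) K.
  rewrite (bigD1 (Ordinal lt_aK)) //= big1 ?addr0 // => c ne_c.
  apply: scomp_ne (hxp c) _; move/eqP: ne_c => ne_c e; apply: ne_c.
  by apply/val_inj => /=; lia.
rewrite big1 => [|c _]; last first.
  apply: scomp_ne (hxp c) _; have := ltn_ord c.
  by lia.
suff -> : scomp (a - d) p = 0 by rewrite mulr0 linear0.
rewrite defp linear_sum big1 // => c _.
by apply: scomp_ne (shomog_scomp _ _) _; have := ltn_ord c; lia.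
Qed.

Lemma shomogM d a (x p : R) : x \is d.-homog -> shomog a p -> shomog (a + d) (x * p).
Proof.
move=> hx; case: a => [/shomog_eq0-> | a /shomogE hp].
  by rewrite mulr0; apply: shomog0.
by rewrite addSn addnC; apply/shomogE/dhomogM.
Qed.

End ShiftedDegree.

#[global] Arguments scomp {k n} a p : simpl never.

(** * Division by a variable and exterior signs *)

Section DivideByVariable.
Variables (k : fieldType) (n : nat).
Local Notation R := {mpoly k[n]}.

(** Contraction by a dual variable: monomials free of ['X_i] are killed. It is a left inverse of
    multiplication by ['X_i] and commutes with the other variables, which is all that the homotopy
    below requires. *)
Definition xquo (i : 'I_n) (p : R) : R :=
  \sum_(u <- msupp p | (U_(i) <= u)%MM) p@_u *: 'X_[u - U_(i)].

Lemma mcoeff_xquo i p u : (xquo i p)@_u = p@_(u + U_(i)).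
Proof.
rewrite /xquo raddf_sum /= [in RHS](mpolyE p) raddf_sum /=.
rewrite [RHS](bigID (fun m => U_(i) <= m)%MM) /= [X in _ + X]big1 ?addr0.
  apply: eq_bigr => m le_im; rewrite !mcoeffZ !mcoeffX; congr (_ * (_ : bool)%:R).
  by rewrite -{2}(submK le_im) eqm_add2r.
move=> m nle; rewrite mcoeffZ mcoeffX; case: eqP => [mu|_]; last by rewrite mulr0.
by rewrite mu addmC lem_addr in nle.
Qed.

Fact xquo_is_linear i : linear (xquo i).
Proof.
by move=> c p q; apply/mpolyP => u; rewrite !(mcoeffD, mcoeffZ, mcoeff_xquo).
Qed.
HB.instance Definition _ i := GRing.isLinear.Build k R R _ (xquo i) (xquo_is_linear i).

Lemma mcoeffXM i (p : R) u : ('X_i * p)@_u = if (U_(i) <= u)%MM then p@_(u - U_(i))%MM else 0.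
Proof. by rewrite mulrC mcoeffMXE. Qed.

Lemma xquoXM i p : xquo i ('X_i * p) = p.
Proof. by apply/mpolyP => u; rewrite mcoeff_xquo mcoeffXM lem_addl addmK. Qed.

Lemma xquoXM_ne i j p : i != j -> xquo i ('X_j * p) = 'X_j * xquo i p.
Proof.
move=> ne_ij; apply/mpolyP => u; rewrite mcoeff_xquo !mcoeffXM !lep1mP.
rewrite mnmDE mnm1E (negPf ne_ij) addn0; case: ifP => // u_j.
rewrite mcoeff_xquo; congr (_@_ _); apply/mnmP => l; rewrite !(mnmBE, mnmDE) !mnm1E.
by case: (j =P l) => [<-|_]; lia.
Qed.

Lemma xquoC i j p : xquo i (xquo j p) = xquo j (xquo i p).
Proof. by apply/mpolyP => u; rewrite !mcoeff_xquo -!addmA (addmC U_(i)%MM). Qed.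

Lemma shomog_xquo i a p : shomog a.+1 p -> shomog a (xquo i p).
Proof.
move/shomogP => h; apply/shomogP => u ne_u; rewrite mcoeff_xquo h //.
by rewrite mdegD mdeg1; lia.
Qed.

Lemma shomogXM i a (p : R) : shomog a p -> shomog a.+1 ('X_i * p).
Proof. by move=> h; rewrite -addn1; apply: shomogM h; rewrite dhomogX /= mdeg1. Qed.

Lemma mcoeff0_XM i (p : R) : ('X_i * p)@_0%MM = 0.
Proof. by rewrite mcoeffXM lep1mP mnm0E. Qed.

Lemma xquo_eq0_const p : (forall i, xquo i p = 0) -> p = (p@_0%MM)%:MP.
Proof.
move=> h; apply/mpolyP => u; rewrite mcoeffC.
have [-> | nz_u] := eqVneq u 0%MM; first by rewrite mulr1.
have [i u_i] : exists i, u i != 0%N.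
  apply/existsP; apply: contraNT nz_u; rewrite negb_exists => /forallP h0.
  by apply/eqP/mnmP => i; rewrite mnm0E; have := h0 i; rewrite negbK => /eqP.
rewrite mulr0 -(submK (_ : (U_(i) <= u)%MM)) ?lep1mP //.
by rewrite -mcoeff_xquo h mcoeff0.
Qed.

End DivideByVariable.

Section SignedFlip.
Variable n : nat.
Implicit Types (i j : 'I_n) (S : {set 'I_n}).

(** One involution serves for adding and for removing [i], so contraction and exterior
    multiplication share their sign lemmas. *)
Definition flip i S := if i \in S then S :\ i else i |: S.

Lemma in_flip i j S : (j \in flip i S) = (j \in S) (+) (i == j).
Proof.
rewrite /flip; case: ifP => iS; rewrite !inE (eq_sym j).
  by case: eqP => [<-|_]; rewrite ?iS //= addbF.
by case: eqP => [<-|_]; rewrite ?iS //= addbF.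
Qed.

Lemma flipK i : involutive (flip i).
Proof. by move=> S; apply/setP => j; rewrite !in_flip -addbA addbb addbF. Qed.

Lemma flipC i j S : flip i (flip j S) = flip j (flip i S).
Proof. by apply/setP => l; rewrite !in_flip addbAC. Qed.

Lemma card_flip i S : #|flip i S| = if i \in S then #|S|.-1 else #|S|.+1.
Proof.
rewrite /flip; case: ifP => iS; last by rewrite cardsU1 iS.
by rewrite [in RHS](cardsD1 i) iS.
Qed.

(* The exponent of the sign of [e_i /\ e_S]. *)
Definition npred i S := #|[set j in S | (j < i)%N]|.

Lemma npred_flip i S : npred i (flip i S) = npred i S.
Proof.
by congr #|pred_of_set _|; apply/setP => j; rewrite !inE in_flip; case: eqP => [<-|];
  rewrite ?addbF // ltnn !andbF.
Qed.

Lemma odd_npred_flip i j S : i != j ->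
  odd (npred j (flip i S)) = odd (npred j S) (+) (i < j)%N.
Proof.
move=> ne; rewrite /npred (cardsD1 i [set l in flip i S | _]) (cardsD1 i [set l in S | _]).
set A := _ :\ i; set B := _ :\ i; have -> : A = B.
  apply/setP => l; rewrite !inE in_flip; case: (eqVneq l i) => //= nli.
  by rewrite addbF.
rewrite !inE in_flip eqxx !oddD.
by case: (i \in S); case: (i < j)%N; case: (odd #|B|).
Qed.

Section Op.
Variable M : zmodType.
Implicit Type c : {set 'I_n} -> M.

Definition signed (e : bool) (x : M) := if e then - x else x.

(* [kop false i] contracts with the i-th coordinate form, [kop true i] is
   exterior multiplication by [e_i]. *)
Definition kop (b : bool) i c S : M :=
  if (i \in S) == b then signed (odd (npred i S)) (c (flip i S)) else 0.

(** Flipping [i] changes the sign exponent at [j] only when [i < j], and exactly one of [i < j],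
    [j < i] holds. Hence the two orders differ by one sign, whichever mixture of contraction and
    multiplication is taken. *)
Lemma kopA b b' i j c S : i != j -> kop b i (kop b' j c) S = - kop b' j (kop b i c) S.
Proof.
move=> ne; have ne' : j != i by rewrite eq_sym.
rewrite /kop !in_flip (negPf ne) (negPf ne') !addbF flipC.
case: ((i \in S) == b); case: ((j \in S) == b'); rewrite /signed ?oppr0 //=; last first.
  by case: odd; rewrite ?oppr0.
  by case: odd; rewrite ?oppr0.
rewrite (odd_npred_flip _ ne) (odd_npred_flip S ne').
have : (i < j)%N = ~~ (j < i)%N by rewrite -leqNgt ltn_neqAle (inj_eq val_inj) ne.
by move=> ->; case: (j < i)%N; case: odd; case: odd; rewrite /= ?opprK.
Qed.

Lemma kopK b i c S : kop b i (kop b i c) S = 0.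
Proof.
rewrite /kop in_flip eqxx addbT; case: ((i \in S) =P b) => // <-.
by case: (i \in S); rewrite /signed /=; case: odd; rewrite ?oppr0.
Qed.

Lemma kopN b i c S : kop b i (kop (~~ b) i c) S = if (i \in S) == b then c S else 0.
Proof.
rewrite /kop in_flip eqxx addbT npred_flip flipK; case: eqP => // ->.
by rewrite eqxx /signed; case: odd; rewrite ?opprK.
Qed.

Lemma kop_ext b i c c' S : c (flip i S) = c' (flip i S) -> kop b i c S = kop b i c' S.
Proof. by rewrite /kop => ->. Qed.

End Op.

Lemma kop_additive (M M' : zmodType) (f : {additive M -> M'}) b i (c : {set 'I_n} -> M) S :
  f (kop b i c S) = kop b i (fun T => f (c T)) S.
Proof.
by rewrite /kop /signed; case: ifP; rewrite ?raddf0 //; case: odd; rewrite ?raddfN.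
Qed.

Lemma kopB (M : zmodType) b i (c c' : {set 'I_n} -> M) S :
  kop b i (fun T => c T - c' T) S = kop b i c S - kop b i c' S.
Proof.
rewrite /kop /signed; case: ifP; rewrite ?subr0 // => _.
by case: odd; rewrite // opprD.
Qed.

End SignedFlip.

(** * The Koszul complex of the ring *)

Section KoszulDifferential.
Variables (k : fieldType) (n : nat).
Local Notation R := {mpoly k[n]}.
Implicit Types (i j : 'I_n) (S T : {set 'I_n}) (b : bool).

(** For [b = false] this is the Koszul differential, for [b = true] its transpose. A chain is
    defined on all subsets at once; [trunc] below cuts out one homological degree. *)
Definition kd (M : lmodType R) (b : bool) (c : {set 'I_n} -> M) (S : {set 'I_n}) : M :=
  \sum_(i < n) 'X_i *: kop b i c S.

Lemma kd_ext (M : lmodType R) b (c c' : {set 'I_n} -> M) S :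
  (forall i, (i \in S) == b -> c (flip i S) = c' (flip i S)) -> kd b c S = kd b c' S.
Proof.
move=> h; apply: eq_bigr => i _; congr (_ *: _).
by rewrite /kop; case: ifP => // /h ->.
Qed.

Lemma kd_kd (M : lmodType R) b (c : {set 'I_n} -> M) S : kd b (kd b c) S = 0.
Proof.
have -> : kd b (kd b c) S =
    \sum_(i < n) \sum_(j < n) ('X_i * 'X_j) *: kop b i (kop b j c) S.
  apply: eq_bigr => i _; rewrite /kop; case: ifP => iS; last first.
    by rewrite scaler0 big1 // => j _; rewrite scaler0.
  rewrite /kd /signed; case: odd; rewrite ?scalerN scaler_sumr -?sumrN.
    by apply: eq_bigr => j _; rewrite scalerN scalerA.
  by apply: eq_bigr => j _; rewrite scalerA.
rewrite pair_big /= (bigID (fun p : 'I_n * 'I_n => (p.1 < p.2)%N)) /=.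
rewrite [X in _ + X](bigID (fun p : 'I_n * 'I_n => p.1 == p.2)) /=.
rewrite [X in _ + (X + _)]big1 ?add0r => [|[i j] /= /andP[_ /eqP ->]]; last first.
  by rewrite kopK scaler0.
pose sw (p : 'I_n * 'I_n) := (p.2, p.1).
rewrite [X in _ + X](reindex_inj (_ : injective sw)) => [|[i j] [i' j'] [-> ->] //].
rewrite -[X in _ + X]opprK -sumrN /=; apply/eqP; rewrite subr_eq0; apply/eqP.
apply: eq_big => [[i j]|[i j] /= lt_ij].
  by rewrite /= -leqNgt ltn_neqAle andbC (inj_eq val_inj) [i == j]eq_sym.
rewrite kopA ?scalerN 1?mulrC //.
by apply/eqP => e; rewrite e ltnn in lt_ij.
Qed.

Lemma kd_linear (M M' : lmodType R) (f : {linear M -> M'}) b (c : {set 'I_n} -> M) S :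
  f (kd b c S) = kd b (fun T => f (c T)) S.
Proof.
by rewrite linear_sum; apply: eq_bigr => i _; rewrite linearZ kop_additive.
Qed.

Lemma kdB (M : lmodType R) b (c c' : {set 'I_n} -> M) S :
  kd b (fun T => c T - c' T) S = kd b c S - kd b c' S.
Proof.
by rewrite -sumrB; apply: eq_bigr => i _; rewrite kopB scalerBr.
Qed.

Lemma kd0 (M : lmodType R) b S : kd b (fun=> 0 : M) S = 0.
Proof.
by apply: big1 => i _; rewrite /kop /signed; do 2?case: ifP => _; rewrite ?oppr0 scaler0.
Qed.

Definition trunc (M : zmodType) q (c : {set 'I_n} -> M) S := if #|S| == q then c S else 0.

Lemma kd_trunc (M : lmodType R) b q (c : {set 'I_n} -> M) S :
  kd b (trunc q c) S =
  if (if b then #|S| == q.+1 else #|S|.+1 == q) then kd b c S else 0.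
Proof.
have card_b i : (i \in S) == b -> (#|flip i S| == q) = (if b then #|S| == q.+1 else #|S|.+1 == q).
  move/eqP=> iS; rewrite card_flip iS; case: b iS => // iS.
  by have := cardsD1 i S; rewrite iS => ->.
case: ifP => h; first by apply: kd_ext => i /card_b e; rewrite /trunc e h.
by rewrite -[RHS](kd0 M b S); apply: kd_ext => i /card_b e; rewrite /trunc e h.
Qed.

(* The differential of the Koszul complex of the ring itself; unlike [kd] on
   the regular module it lives in the ring. *)
Definition kdr b (c : {set 'I_n} -> R) S : R := kd b (c : {set 'I_n} -> R^o) S.

Lemma kdrE b (c : {set 'I_n} -> R) S : kdr b c S = \sum_(i < n) 'X_i * kop b i c S.
Proof. by []. Qed.

Lemma kdr_trunc b q (c : {set 'I_n} -> R) S :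
  kdr b (trunc q c) S =
  if (if b then #|S| == q.+1 else #|S|.+1 == q) then kdr b c S else 0.
Proof. exact: (@kd_trunc R^o). Qed.

Section Exactness.
Variable b : bool.
Implicit Type c w : {set 'I_n} -> R^o.

(* Dividing by ['X_i] and applying the opposite operation in direction [i] is a
   homotopy from the identity to the map that sets ['X_i] to 0 on one half of
   the complex and kills the other half. *)
Lemma kd_homotopy i c S : (forall T, kd b c T = 0) ->
  kd b (kop (~~ b) i (fun T => xquo i (c T) : R^o)) S =
  if (i \in S) == b then 'X_i * xquo i (c S) else c S.
Proof.
move=> c0; rewrite /kd (bigD1 i) //= kopN.
have off T : \sum_(j < n | j != i) 'X_j * kop b j (fun T => xquo i (c T) : R^o) T =
             - kop b i c T.
  rewrite -[RHS](xquoXM i) mulrN; move/eqP: (c0 T).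
  rewrite /kd (bigD1 i) //= addrC addr_eq0 => /eqP <-.
  rewrite linear_sum; apply: eq_bigr => j ne_ji /=.
  rewrite [_ *: _]/(_ * _) xquoXM_ne 1?eq_sym //; congr (_ * _).
  by rewrite -(kop_additive (xquo i : {additive R -> R})).
case: (boolP ((i \in S) == b)) => iS.
  rewrite big1 ?addr0 // => j ne_ji; rewrite kopA // [kop (~~ b) i _ S]/kop.
  by rewrite (_ : _ == ~~ b = false) ?oppr0 ?scaler0 // (eqP iS); case: b.
have iS' : (i \in S) == ~~ b by case: (i \in S) iS; case: b.
rewrite scaler0 add0r.
rewrite (eq_bigr (fun j => - ('X_j * kop (~~ b) i (kop b j (fun T => xquo i (c T) : R^o)) S))).
  rewrite sumrN /kop iS' -/(kop _ _ _).
  transitivity (- signed (odd (npred i S)) (\sum_(j < n | j != i)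
     'X_j * kop b j (fun T => xquo i (c T) : R^o) (flip i S))).
    congr (- _); rewrite /signed; case: odd => //.
    by rewrite -sumrN; apply: eq_bigr => j _; rewrite mulrN.
  rewrite off; have := kopN (~~ b) i c S; rewrite negbK iS' => <-.
  by rewrite [in RHS]/kop iS' /signed; case: odd; rewrite ?opprK.
by move=> j ne_ji; rewrite kopA 1?eq_sym // mulrN opprK.
Qed.

Lemma kop_shomog a i c S : (forall T, shomog a (c T)) -> shomog a (kop (~~ b) i c S : R).
Proof.
move=> h; rewrite /kop /signed; case: ifP => _; last exact: shomog0.
by case: odd => //; apply: shomogN.
Qed.

(** The homology of the Koszul complex of [R] is the field, carried by the empty set for [b = false]
    and by the full set for [b = true]; the hypothesis on the constant term removes that one
    class. *)
Lemma koszul_exact a c :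
  (forall S, shomog a.+1 (c S)) -> (forall S, kd b c S = 0) ->
  (c (if b then setT else set0) : R)@_0%MM = 0 ->
  exists w : {set 'I_n} -> R^o, (forall S, shomog a (w S)) /\ (forall S, c S = kd b w S).
Proof.
move=> c_a c0 cS0.
(* Modulo a boundary, [c] becomes free of the variables in [r] and is supported on the sets [S] that
   lie on side [b] of each of them. Once all variables are treated, only a constant at the extreme
   set can remain. *)
have reduce (r : seq 'I_n) : exists w c',
  [/\ (forall S, shomog a (w S)) /\ (forall S, shomog a.+1 (c' S)),
      forall S, c S = kd b w S + c' S, forall S, kd b c' S = 0 &
      forall i, i \in r -> forall S, ((i \in S) != b -> c' S = 0) /\ xquo i (c' S) = 0].
  elim: r => [|i r [w [c' [[w_a c'_a] cE c'0 red]]]].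
    exists (fun=> 0), c; split=> //.
    - by split=> // S; apply: shomog0.
    - by move=> S; rewrite kd0 add0r.
  pose h := kop (~~ b) i (fun T => xquo i (c' T) : R^o).
  have c''E S : c' S - kd b h S = if (i \in S) == b then c' S - 'X_i * xquo i (c' S) else 0.
    by rewrite kd_homotopy //; case: ifP => // _; rewrite subrr.
  exists (fun S => w S - (- h S)), (fun S => c' S - kd b h S); split.
  - split=> S.
      apply: shomogD; rewrite // opprK; apply: kop_shomog => T.
      by apply: shomog_xquo.
    rewrite c''E; case: ifP => _; last exact: shomog0.
    by apply: shomogD => //; apply/shomogN/shomogXM/shomog_xquo.
  - move=> S; rewrite kdB.
    have -> : kd b (fun T => - h T) S = - kd b h S.
      by rewrite -[RHS]sub0r -(kd0 _ b S) -kdB; apply: kd_ext => j _; rewrite sub0r.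
    by rewrite cE opprK -addrA [kd b h S + _]addrC subrK.
  - by move=> S; rewrite kdB c'0 kd_kd subr0.
  move=> j; rewrite inE => j_ir S; rewrite c''E; split.
    case: ifP => // iS; case/predU1P: j_ir => [-> | jr]; first by rewrite iS.
    by move=> jS; rewrite (red j jr S).1 // linear0 mulr0 subr0.
  case: ifP => iS; last by rewrite linear0.
  case: (eqVneq j i) j_ir => [-> _ | ne_ji /= jr].
    by rewrite linearB /= xquoXM subrr.
  by rewrite linearB /= xquoXM_ne // xquoC (red j jr S).2 linear0 mulr0 subr0.
have [w [c' [[w_a _] cE _ red]]] := reduce (enum 'I_n).
exists w; split=> // S; rewrite cE.
suff -> : c' S = 0 by rewrite addr0.
have [S0 | nS0] := eqVneq S (if b then setT else set0); last first.
  have /existsP[i iS] : [exists i, (i \in S) != b].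
    apply: contraNT nS0; rewrite negb_exists => /forallP h; apply/eqP/setP => i.
    by have := h i; rewrite negbK => /eqP ->; case: b; rewrite !inE.
  exact: (red i (mem_enum _ _) S).1.
rewrite (@xquo_eq0_const _ _ (c' S)) => [|i]; last exact: (red i (mem_enum _ _) S).2.
suff -> : (c' S : R)@_0%MM = 0 by rewrite mpolyC0.
move: cS0; rewrite -S0 cE mcoeffD => <-; rewrite [X in X + _](_ : _ = 0) ?add0r //.
by rewrite raddf_sum big1 // => i _; apply: mcoeff0_XM.
Qed.

Lemma kdr_exact a (c : {set 'I_n} -> R) :
  (forall S, shomog a.+1 (c S)) -> (forall S, kdr b c S = 0) ->
  (c (if b then setT else set0))@_0%MM = 0 ->
  exists w : {set 'I_n} -> R, (forall S, shomog a (w S)) /\ (forall S, c S = kdr b w S).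
Proof. exact: koszul_exact. Qed.

Lemma kdr_shomog a (c : {set 'I_n} -> R) S :
  (forall T, shomog a (c T)) -> shomog a.+1 (kdr b c S).
Proof.
move=> h; apply: shomog_sum => i _; apply: shomogXM; rewrite /kop /signed.
case: ifP => _; last exact: shomog0.
by case: odd; [apply: shomogN |].
Qed.

End Exactness.
End KoszulDifferential.

(** * Duality *)

Section Monomials.
Variables (k : fieldType) (n : nat).
Local Notation R := {mpoly k[n]}.

Definition mons (a : nat) : seq 'X_{1..n} :=
  if a is d.+1 then [seq mono_of u | u <- enum {: expT n d}] else [::].

Lemma mdeg_mono_of d (u : expT n d) : mdeg (mono_of u) = d.
Proof.
rewrite mdegE -[RHS](eqP (valP u)); apply: eq_bigr => i _; exact: mnmE.
Qed.

Lemma mono_of_inj d : injective (@mono_of n d).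
Proof.
move=> u v e; apply/val_inj/ffunP => i; apply/val_inj => /=.
by move/mnmP: e => /(_ i); rewrite !mnmE.
Qed.

Lemma mono_of_surj d (u : 'X_{1..n}) : mdeg u = d -> exists v : expT n d, mono_of v = u.
Proof.
move=> <-.
have le_u i : (u i < (mdeg u).+1)%N by rewrite ltnS mdegE (bigD1 i) //= leq_addr.
pose v := [ffun i => Ordinal (le_u i)].
have v_deg : \sum_(i < n) (v i : nat) == mdeg u.
  apply/eqP; transitivity (\sum_(i < n) u i)%N; last by rewrite mdegE.
  by apply: eq_bigr => i _; rewrite ffunE.
by exists (Sub v v_deg); apply/mnmP => i; rewrite mnmE SubK ffunE.
Qed.

Lemma mem_mons a u : (u \in mons a) = ((mdeg u).+1 == a).
Proof.
case: a => [|a] /=; rewrite ?in_nil // eqSS; apply/mapP/eqP => [[v _ ->] | <-].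
  exact: mdeg_mono_of.
by have [v vE] := mono_of_surj (erefl (mdeg u)); exists v; rewrite ?mem_enum ?vE.
Qed.

Lemma uniq_mons a : uniq (mons a).
Proof.
by case: a => //= a; rewrite (map_inj_uniq (@mono_of_inj a)) enum_uniq.
Qed.

Lemma shomog_expand a (p : R) : shomog a p -> p = \sum_(u : seq_sub (mons a)) p@_(val u) *: 'X_[val u].
Proof.
move/shomogP => h; apply/mpolyP => v; rewrite raddf_sum /=.
have [va | nva] := boolP (v \in mons a).
  rewrite (bigD1 (Sub v va)) //= big1 ?addr0 => [|u ne_u].
    by rewrite mcoeffZ mcoeffX eqxx mulr1.
  rewrite mcoeffZ mcoeffX; case: eqP => [e | _]; last by rewrite mulr0.
  by case/eqP: ne_u; apply/val_inj.
rewrite h; last by move/eqP; rewrite -mem_mons (negPf nva).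
rewrite big1 // => u _; rewrite mcoeffZ mcoeffX; case: eqP => [e | _]; last by rewrite mulr0.
by rewrite -e (valP u) in nva.
Qed.

Lemma shomogX a (u : seq_sub (mons a)) : shomog a ('X_[val u] : R).
Proof.
apply/shomogP => v ne; rewrite mcoeffX; case: eqP => // e.
by have := valP u; rewrite mem_mons e => /eqP.
Qed.

End Monomials.

Lemma sum_enum_val (V : nmodType) (U : finType) (F : U -> V) :
  \sum_u F u = \sum_(i < #|U|) F (enum_val i).
Proof. by rewrite -big_enum_val. Qed.

(** The Fredholm alternative: a functional that vanishes on the kernel of [P] lies in its row
    space. *)
Lemma separation (k : fieldType) (T U : finType) (P : T -> U -> k) (g : U -> k) :
  (forall y : U -> k, (forall t, \sum_u P t u * y u = 0) -> \sum_u g u * y u = 0) ->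
  exists w : T -> k, forall u, g u = \sum_t w t * P t u.
Proof.
move=> h; pose A := \matrix_(i < #|T|, j < #|U|) P (enum_val i) (enum_val j).
pose r := \row_(j < #|U|) g (enum_val j).
have : (r <= A)%MS.
  rewrite submxE; apply/eqP/matrixP => i0 j; rewrite ord1 [LHS]mxE [RHS]mxE {i0}.
  pose y u := cokermx A (enum_rank u) j.
  rewrite -[RHS](h y) => [|t].
    by rewrite [RHS]sum_enum_val; apply: eq_bigr => l _; rewrite mxE /y enum_valK.
  have /matrixP/(_ (enum_rank t) j) := mulmx_coker A; rewrite [LHS]mxE [RHS]mxE => A0.
  rewrite -[RHS]A0 [LHS]sum_enum_val; apply: eq_bigr => l _.
  by rewrite mxE /y enum_valK enum_rankK.
case/submxP => w rE; exists (fun t => w 0 (enum_rank t)) => u.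
have /rowP/(_ (enum_rank u)) := rE; rewrite [LHS]mxE [RHS]mxE enum_rankK => ->.
by rewrite [RHS]sum_enum_val; apply: eq_bigr => l _; rewrite mxE enum_valK enum_rankK.
Qed.

Section ColumnExactness.
Variables (k : fieldType) (n : nat).
Local Notation R := {mpoly k[n]}.
Implicit Types (S T : {set 'I_n}).

Definition chomog a b (v : 'cV[R]_b) := forall r, shomog a (v r 0).

Definition entry b (r : 'I_b) (v : 'cV[R]_b) : R^o := v r 0.
Fact entry_is_linear b r : linear (@entry b r).
Proof. by move=> c u v; rewrite /entry !mxE. Qed.
HB.instance Definition _ b r := GRing.isLinear.Build R 'cV[R]_b R^o _ (@entry b r)
  (@entry_is_linear b r).

(** [0 < q + a] excludes constants in homological degree 0, where the homology of a free module
    lives. *)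
Lemma koszul_exact_col b a q (c : {set 'I_n} -> 'cV[R]_b) :
  (forall S, #|S| = q -> chomog a.+1 (c S)) ->
  (forall S, #|S|.+1 = q -> kd false c S = 0) -> (0 < q + a)%N ->
  exists w : {set 'I_n} -> 'cV[R]_b, (forall S, chomog a (w S)) /\
    (forall S, #|S| = q -> c S = kd false w S).
Proof.
move=> c_a c0 qa.
have ex_r r : exists w : {set 'I_n} -> R^o, (forall S, shomog a (w S)) /\
    (forall S, #|S| = q -> c S r 0 = kd false w S).
  have tr_a S : shomog a.+1 (entry r (trunc q c S)).
    rewrite /trunc; case: eqP => [Sq | _]; first exact: c_a.
    by rewrite linear0; apply: shomog0.
  have [S||w [w_a wE]] := koszul_exact (b := false) tr_a.
  - rewrite -kd_linear kd_trunc; case: eqP => [/c0 ->|_]; apply: linear0.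
  - rewrite /trunc cards0; case: eqP => [q0|_]; last by rewrite linear0 mcoeff0.
    have /shomogP -> // : shomog a.+1 (c set0 r 0) by apply: c_a; rewrite cards0.
    by rewrite mdeg0 => -[a0]; rewrite -q0 -a0 in qa.
  exists w; split=> // S Sq.
  by have := wE S; rewrite /trunc Sq eqxx.
have [w w_ok] := fin_all_exists ex_r.
exists (fun S => \col_r w r S); split=> [S r | S Sq].
  by rewrite mxE; apply: (w_ok r).1.
apply/colP => r; rewrite (w_ok r).2 // -[RHS]/(entry r _) kd_linear.
by apply: (@kd_ext _ _ R^o) => i _; rewrite /= /entry mxE.
Qed.

End ColumnExactness.

Section Duality.
Variables (k : fieldType) (n : nat).
Local Notation R := {mpoly k[n]}.
Implicit Types (S T : {set 'I_n}).
Variables (lam : {scalar R}) (s : nat).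
Hypothesis lam_s : forall a p, shomog a p -> a <> s.+1 -> lam p = 0.

Definition annih (p : R) : Prop := forall q, lam (p * q) = 0.

Lemma annih0 : annih 0.
Proof. by move=> q; rewrite mul0r linear0. Qed.

Lemma annihD p q : annih p -> annih q -> annih (p + q).
Proof. by move=> hp hq r; rewrite mulrDl linearD hp hq addr0. Qed.

Lemma annihM p q : annih p -> annih (q * p).
Proof. by move=> hp r; rewrite mulrAC mulrC hp. Qed.

Lemma shomogMM a a' (p q : R) : shomog a p -> shomog a' q -> shomog (a + a').-1 (p * q).
Proof.
case: a => [/shomog_eq0-> _ | a /shomogE hp hq]; first by rewrite mul0r; apply: shomog0.
by rewrite addSn addnC; apply: shomogM.
Qed.

(** Indices [d] and [a] multiply into index [d + a - 1], and [lam] only sees index [s + 1]; so only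
    multipliers of index [s + 2 - d] matter. *)
Lemma annih_test d p : shomog d p ->
  (forall q, shomog (s.+2 - d) q -> lam (p * q) = 0) -> annih p.
Proof.
move=> hp h q; have [K ->] := scomp_sum q; rewrite mulr_sumr linear_sum big1 // => a _.
have [e | ne] := eqVneq (d + a)%N s.+2.
  by apply: h; rewrite -e addKn; apply: shomog_scomp.
case: (posnP d) hp => [-> /shomog_eq0-> | d_gt0 hp]; first by rewrite mul0r linear0.
apply: (lam_s (shomogMM hp (shomog_scomp a q))); move/eqP: ne; lia.
Qed.

Lemma annih_scomp a p : annih p -> annih (scomp a p).
Proof.
move=> hp; apply: (annih_test (shomog_scomp a p)) => q hq.
have [K defp] := scomp_sum p.
have := hp q; rewrite {1}defp mulr_suml linear_sum /=.
have z c : c != a -> lam (scomp c p * q) = 0.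
  move=> ne; case: (posnP c) => [->|c_gt0]; first by rewrite mul0r linear0.
  case: (ltnP a s.+2) hq => [lt_a | ge_a] hq; last first.
    by move: hq; rewrite (_ : s.+2 - a = 0)%N ?(eqP ge_a) // => /shomog_eq0 ->; rewrite mulr0 linear0.
  by apply: (lam_s (shomogMM (shomog_scomp c p) hq)); move/eqP: ne; lia.
have [lt_aK | le_Ka] := ltnP a K.
  by rewrite (bigD1 (Ordinal lt_aK)) //= big1 ?addr0 // => c ne; apply: z.
move=> _; suff -> : scomp a p = 0 by rewrite mul0r linear0.
rewrite defp linear_sum big1 // => c _.
by apply: scomp_ne (shomog_scomp _ _) _; have := ltn_ord c; lia.
Qed.

(** In each direction [i], reindexing by [flip i] exchanges contraction and exterior multiplication,
    and the sign exponent is invariant under that flip. *)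
Lemma kdr_adjoint (w y : {set 'I_n} -> R) :
  \sum_S lam (kdr false w S * y S) = \sum_S lam (w S * kdr true y S).
Proof.
rewrite -!(linear_sum lam) /=; congr (lam _).
transitivity (\sum_S \sum_(i < n) 'X_i * (kop false i w S * y S)).
  apply: eq_bigr => S _; rewrite kdrE mulr_suml.
  by apply: eq_bigr => i _; rewrite mulrA.
transitivity (\sum_S \sum_(i < n) 'X_i * (w S * kop true i y S)); last first.
  apply: eq_bigr => S _; rewrite kdrE mulr_sumr.
  by apply: eq_bigr => i _; rewrite mulrCA.
rewrite exchange_big [RHS]exchange_big /=.
apply: eq_bigr => i _ /=; rewrite [LHS](reindex_inj (inv_inj (flipK i))) /=.
apply: eq_bigr => S _; rewrite /kop in_flip eqxx addbT npred_flip flipK.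
congr (_ * _).
by case: (i \in S); rewrite /= /signed ?mulr0 ?mul0r //; case: odd; rewrite ?mulrN ?mulNr.
Qed.

(** By [separation], [c] bounds modulo I once it is orthogonal to every cocycle [Y] of A of degree
    [s - a]. The coboundary of [Y] has degree at most [t], where I has no form, so [Y] is a cocycle
    over [R]. Its part in homological degree [q < n] is then a coboundary, and adjointness moves the
    differential onto [c], whose boundary lies in I. *)
Lemma koszul_dual (t q a : nat) (c : {set 'I_n} -> R) :
  (forall d p, (d <= t.+1)%N -> shomog d p -> annih p -> p = 0) ->
  (q < n)%N -> (s < a + t)%N ->
  (forall S, #|S| = q -> shomog a.+1 (c S)) ->
  (forall S, #|S|.+1 = q -> annih (kdr false c S)) ->
  exists w : {set 'I_n} -> R, (forall S, shomog a (w S)) /\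
    (forall S, #|S| = q -> annih (c S - kdr false w S)).
Proof.
move=> low lt_qn lt_s c_a c_ann.
have [le_as | lt_sa] := leqP a s; last first.
  exists (fun=> 0); split=> [S | S Sq]; first exact: shomog0.
  rewrite [kdr _ _ _](@kd0 k n R^o) subr0; apply: (annih_test (c_a S Sq)) => p.
  by rewrite (_ : s.+2 - a.+1 = 0)%N; [move/shomog_eq0->; rewrite mulr0 linear0 | lia].
(* Basis chains of degree [a - 1] and basis cochains of degree [s - a]: with one differential in
   between, their products have degree [s], where [lam] lives. *)
pose Ta := ({set 'I_n} * seq_sub (mons n a))%type.
pose Ty := ({set 'I_n} * seq_sub (mons n (s.+1 - a)))%type.
pose fam d (u : {set 'I_n} * seq_sub (mons n d) -> k) S : R :=
  \sum_m u (S, m) *: 'X_[val m].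
have fam_d d u S : shomog d (fam d u S).
  by apply: shomog_sum => m _; apply/shomogZ/shomogX.
pose e d (x : {set 'I_n} * seq_sub (mons n d)) S : R :=
  if S == x.1 then 'X_[val x.2] else 0.
pose P (x : Ta) (y : Ty) := lam (kdr false (e _ x) y.1 * 'X_[val y.2]).
have lam_e d (x : {set 'I_n} * seq_sub (mons n d)) (G : {set 'I_n} -> R) :
    \sum_S lam (G S * e d x S) = lam (G x.1 * 'X_[val x.2]).
  rewrite (bigD1 x.1) //= /e eqxx big1 ?addr0 // => S /negPf ne.
  by rewrite ne mulr0 linear0.
have lam_fam d u (G : {set 'I_n} -> R) :
    \sum_S lam (G S * fam d u S) = \sum_x lam (G x.1 * 'X_[val x.2]) * u x.
  transitivity (\sum_S \sum_m lam (G S * 'X_[val m]) * u (S, m)); last first.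
    by rewrite pair_bigA; apply: eq_bigr => -[S m].
  apply: eq_bigr => S _; rewrite mulr_sumr linear_sum; apply: eq_bigr => m _ /=.
  rewrite -scalerAr linearZ /=; exact: mulrC.
have PE (x : Ta) (y : Ty) : P x y = lam (kdr true (e _ y) x.1 * 'X_[val x.2]).
  rewrite /P -(lam_e _ y (kdr false (e _ x))) kdr_adjoint -(lam_e _ x).
  by apply: eq_bigr => S _; rewrite mulrC.
have [y yP | w wE] := @separation k Ta Ty P (fun y => lam (trunc q c y.1 * 'X_[val y.2])).
  pose Y := fam _ y.
  have dY S : kdr true Y S = 0.
    have hd : shomog (s.+1 - a).+1 (kdr true Y S) by apply/kdr_shomog/fam_d.
    apply: (low _ _ _ hd); first by lia.
    apply: (annih_test hd) => p; rewrite (_ : s.+2 - _ = a)%N; last by lia.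
    move=> hp; rewrite (shomog_expand hp) mulr_sumr linear_sum big1 // => m _ /=.
    rewrite -scalerAr linearZ /= [lam _](_ : _ = 0) ?mulr0 //.
    rewrite -[RHS](yP (S, m)) -(lam_fam _ y (kdr false (e _ (S, m)))) kdr_adjoint.
    by rewrite -(lam_e _ (S, m)); apply: eq_bigr => S' _; rewrite mulrC.
  have Yq_d S : shomog (s - a).+1 (trunc q Y S).
    rewrite /trunc -subSn //; case: ifP => _; [exact: fam_d | exact: shomog0].
  have [S||y' [_ y'E]] := kdr_exact (b := true) Yq_d.
  - by rewrite kdr_trunc dY if_same.
  - by rewrite /trunc cardsT card_ord gtn_eqF ?mcoeff0.
  rewrite -(lam_fam _ y (trunc q c)).
  transitivity (\sum_S lam (trunc q c S * kdr true y' S)).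
    apply: eq_bigr => S _; rewrite -y'E /trunc.
    by case: ifP; rewrite ?mul0r.
  rewrite -kdr_adjoint big1 // => S _; rewrite kdr_trunc.
  by case: eqP => [/c_ann//|_]; rewrite mul0r linear0.
exists (fam _ w); split=> [S | S Sq]; first exact: fam_d.
have cE : c S = trunc q c S by rewrite /trunc Sq eqxx.
apply: (annih_test (d := a.+1)).
  apply: shomogD; first exact: c_a.
  exact/shomogN/kdr_shomog/fam_d.
rewrite subSS => p hp; rewrite (shomog_expand hp) mulr_sumr linear_sum big1 // => m _ /=.
rewrite -scalerAr linearZ /= mulrBl linearB /= cE (wE (S, m)).
suff -> : \sum_t w t * P t (S, m) = lam (kdr false (fam a w) S * 'X_[val m]).
  by rewrite subrr mulr0.
rewrite -(lam_e _ (S, m) (kdr false (fam a w))) kdr_adjoint.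
under [RHS]eq_bigr do rewrite mulrC.
by rewrite lam_fam; apply: eq_bigr => x _; rewrite PE mulrC.
Qed.

End Duality.

(** * Koszul homology of syzygies *)

Section GradedColumns.
Variables (k : fieldType) (n : nat).
Local Notation R := {mpoly k[n]}.

Definition ccomp a b (v : 'cV[R]_b) : 'cV[R]_b := map_mx (scomp a) v.

Lemma ccompP a b (v : 'cV[R]_b) : chomog a v <-> ccomp a v = v.
Proof.
split=> [h | <- r]; last by rewrite mxE; apply: shomog_scomp.
by apply/colP => r; rewrite mxE h.
Qed.

Lemma chomog_ccomp a b (v : 'cV[R]_b) : chomog a (ccomp a v).
Proof. by move=> r; rewrite mxE; apply: shomog_scomp. Qed.

Lemma chomog_eq0 b (v : 'cV[R]_b) : chomog 0 v -> v = 0.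
Proof. by move=> h; apply/colP => r; rewrite mxE (shomog_eq0 (h r)). Qed.

Lemma chomog0 a b : chomog a (0 : 'cV[R]_b).
Proof. by move=> r; rewrite mxE; apply: shomog0. Qed.

Lemma chomogB a b (u v : 'cV[R]_b) : chomog a u -> chomog a v -> chomog a (u - v).
Proof. by move=> hu hv r; rewrite !mxE; apply: shomogD; [|apply: shomogN]. Qed.

Lemma ccomp_sum b (v : 'cV[R]_b) : exists K, v = \sum_(a < K) ccomp a v.
Proof.
have ex r : exists K, forall a, (K <= a)%N -> scomp a (v r 0) = 0.
  have [K defv] := scomp_sum (v r 0); exists K => a le_Ka; rewrite defv linear_sum big1 // => c _.
  by apply: scomp_ne (shomog_scomp _ _) _; have := ltn_ord c; lia.
have [K hK] := fin_all_exists ex; exists (\max_r K r)%N; apply/colP => r.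
rewrite summxE; transitivity (\sum_(a < \max_r K r) scomp a (v r 0)); last first.
  by apply: eq_bigr => a _; rewrite mxE.
have [K' defv] := scomp_sum (v r 0).
apply/mpolyP => u; rewrite raddf_sum /=.
have coefE a : (scomp a (v r 0))@_u = if a == (mdeg u).+1 then (v r 0)@_u else 0.
  by rewrite mcoeff_scomp eq_sym.
have [lt_u | le_u] := ltnP (mdeg u).+1 (\max_r K r).
  rewrite (bigD1 (Ordinal lt_u)) //= coefE eqxx big1 ?addr0 // => a ne.
  rewrite coefE; case: eqP => // e; case/eqP: ne; exact/val_inj.
have := congr1 (mcoeff u) (hK r _ (leq_trans (leq_bigmax r) le_u)).
rewrite coefE eqxx mcoeff0 => ->; rewrite big1 // => a _; rewrite coefE.
by case: eqP => // e; have := ltn_ord a; rewrite e ltnNge le_u.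
Qed.

Lemma kd_chomog a b (c : {set 'I_n} -> 'cV[R]_b) (S : {set 'I_n}) :
  (forall i : 'I_n, i \notin S -> chomog a (c (flip i S))) -> chomog a.+1 (kd false c S).
Proof.
move=> h r; rewrite summxE; apply: shomog_sum => i _; rewrite mxE; apply: shomogXM.
rewrite /kop /signed eqbF_neg; case: ifP => [iS|_]; last by rewrite mxE; apply: shomog0.
by case: odd; rewrite ?mxE; [apply: shomogN|]; apply: h.
Qed.

Definition hmat d b b' (A : 'M[R]_(b, b')) := forall r c, A r c \is d.-homog.

Lemma ccomp_mul d a b b' (A : 'M[R]_(b, b')) w : hmat d A ->
  ccomp a (A *m w) = A *m ccomp (a - d) w.
Proof.
move=> hA; apply/colP => r; rewrite !mxE linear_sum; apply: eq_bigr => c _ /=.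
by rewrite (scompM _ _ (hA r c)) mxE.
Qed.

Lemma chomog_mul d a b b' (A : 'M[R]_(b, b')) w : hmat d A ->
  chomog a w -> chomog (a + d) (A *m w).
Proof. by move=> hA /ccompP hw; apply/ccompP; rewrite (ccomp_mul _ _ hA) addnK hw. Qed.

Definition mon a (j : 'I_(size (mons n a))) : 'X_{1..n} := tnth (in_tuple (mons n a)) j.

Lemma mon_inj a : injective (@mon a).
Proof. by move=> i j; apply/tuple_uniqP/uniq_mons. Qed.

Lemma mon_onto a u : (mdeg u).+1 = a -> exists j, u = @mon a j.
Proof. by move/eqP; rewrite -mem_mons => /(tnthP (in_tuple _)). Qed.

Lemma mdeg_mon a j : (mdeg (@mon a j)).+1 = a.
Proof. by apply/eqP; rewrite -mem_mons; apply: mem_tnth. Qed.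

Definition tocol a b (y : 'M[k]_(b, size (mons n a))) : 'cV[R]_b :=
  \col_r \sum_j y r j *: 'X_[mon j].
Definition fromcol a b (v : 'cV[R]_b) : 'M[k]_(b, size (mons n a)) :=
  \matrix_(r, j) (v r 0)@_(mon j).

Lemma tocolK a b : cancel (@tocol a b) (@fromcol a b).
Proof.
move=> y; apply/matrixP => r j; rewrite !mxE raddf_sum (bigD1 j) //= big1 => [|l ne].
  by rewrite mcoeffZ mcoeffX eqxx mulr1 addr0.
by rewrite mcoeffZ mcoeffX (inj_eq (@mon_inj a)) (negPf ne) mulr0.
Qed.

Lemma chomog_tocol a b (y : 'M[k]_(b, size (mons n a))) : chomog a (tocol y).
Proof.
move=> r; rewrite mxE; apply: shomog_sum => j _; apply/shomogZ/shomogP => u ne.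
by rewrite mcoeffX; case: eqP => // e; case: ne; rewrite -e mdeg_mon.
Qed.

Lemma fromcolK a b (v : 'cV[R]_b) : chomog a v -> tocol (fromcol a v) = v.
Proof.
move=> hv; apply/colP => r; rewrite mxE; apply/mpolyP => u.
have /shomogP h := chomog_tocol (fromcol a v) r; have /shomogP h' := hv r.
rewrite mxE in h.
have [e | ne] := eqVneq (mdeg u).+1 a; last by move/eqP: ne => ne; rewrite h // h'.
have [j ->] := mon_onto e.
by have /matrixP/(_ r j) := tocolK (fromcol a v); rewrite !mxE.
Qed.

Lemma fromcolZ a b c (v : 'cV[R]_b) : fromcol a (c%:MP *: v) = c *: fromcol a v.
Proof. by apply/matrixP => r j; rewrite !mxE mcoeffCM. Qed.

Lemma fromcolD a b (u v : 'cV[R]_b) : fromcol a (u + v) = fromcol a u + fromcol a v.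
Proof. by apply/matrixP => r j; rewrite !mxE mcoeffD. Qed.

Lemma tocolP a b c (y z : 'M[k]_(b, size (mons n a))) :
  tocol (c *: y + z) = c%:MP *: tocol y + tocol z.
Proof.
apply/colP => r; rewrite !mxE mulr_sumr -big_split; apply: eq_bigr => j _ /=.
by rewrite !mxE scalerDl mul_mpolyC scalerA.
Qed.

Lemma tocol0 a b : tocol (0 : 'M[k]_(b, size (mons n a))) = 0.
Proof. by apply/colP => r; rewrite !mxE big1 // => j _; rewrite mxE scale0r. Qed.

Lemma tocol_sum a b (I : Type) (s : seq I) (c : I -> k) (y : I -> 'M[k]_(b, size (mons n a))) :
  tocol (\sum_(i <- s) c i *: y i) = \sum_(i <- s) (c i)%:MP *: tocol (y i).
Proof.
by elim: s => [|i s IH]; rewrite ?big_nil ?tocol0 // !big_cons tocolP IH.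
Qed.

End GradedColumns.

(** Membership is an undecided [Prop], so a subspace inside [P] is enlarged by a vector outside it,
    by excluded middle, until the dimension stops it. This gives bases of graded pieces. *)
Lemma vspace_of_pred (k : fieldType) (V : vectType k) (P : V -> Prop) :
  P 0 -> (forall c u v, P u -> P v -> P (c *: u + v)) ->
  exists U : {vspace V}, forall v, v \in U <-> P v.
Proof.
move=> P0 PL.
have grow d (U : {vspace V}) : (forall v, v \in U -> P v) -> (\dim {: V} - \dim U <= d)%N ->
    exists U' : {vspace V}, forall v, v \in U' <-> P v.
  elim: d U => [|d IH] U UP le_d.
    exists U => v; split; first exact: UP.
    have /eqP -> : U == fullv by rewrite eqEdim subvf; lia.
    by rewrite memvf.
  have [[v [Pv vU]] | none] := classic (exists v, P v /\ v \notin U); last first.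
    exists U => v; split; first exact: UP.
    by move=> Pv; apply/negPn/negP => vU; apply: none; exists v.
  apply: (IH (U + <[v]>)%VS) => [w /memv_addP[u uU [_ /vlineP[c ->] ->]]|].
    by rewrite addrC; apply: PL => //; apply: UP.
  have : (\dim U < \dim (U + <[v]>))%N.
    rewrite ltnNge; apply: contra vU => le.
    have /eqP-> : U == (U + <[v]>)%VS by rewrite eqEdim addvSl.
    by apply: (subvP (addvSr _ _)); apply: memv_line.
  by lia.
apply: (grow (\dim {: V}) 0%VS) => [v|]; last exact: leq_subr.
by rewrite memv0 => /eqP ->.
Qed.

Section Syzygies.
Variables (k : fieldType) (n : nat).
Local Notation R := {mpoly k[n]}.
Implicit Types (S T : {set 'I_n}).

Definition gsubmod b (Z : 'cV[R]_b -> Prop) :=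
  [/\ Z 0, forall u v, Z u -> Z v -> Z (u + v), forall p u, Z u -> Z (p *: u)
    & forall a u, Z u -> Z (ccomp a u)].

(* Vanishing of the [q]-th Koszul homology of [Z] on chains of degree [a] (shifted
   index [a.+1]); boundaries then come from degree [a - 1], whose index is [a]. *)
Definition koszul_van b (Z : 'cV[R]_b -> Prop) q a :=
  forall c : {set 'I_n} -> 'cV[R]_b,
  (forall S, #|S| = q -> Z (c S) /\ chomog a.+1 (c S)) ->
  (forall S, #|S|.+1 = q -> kd false c S = 0) ->
  exists w : {set 'I_n} -> 'cV[R]_b,
    (forall S, #|S| = q.+1 -> Z (w S) /\ chomog a (w S)) /\
    (forall S, #|S| = q -> c S = kd false w S).

Definition mximage b b' (A : 'M[R]_(b, b')) (v : 'cV[R]_b) : Prop :=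
  exists u : 'cV[R]_b', v = A *m u.
Definition mxkernel b b' (A : 'M[R]_(b, b')) (v : 'cV[R]_b') : Prop := A *m v = 0.

Lemma gsubmod_kernel d b b' (A : 'M[R]_(b, b')) : hmat d A -> gsubmod (mxkernel A).
Proof.
move=> hA; split=> [|u v|p u|a u]; rewrite /mxkernel.
- exact: mulmx0.
- by rewrite mulmxDr => -> ->; rewrite addr0.
- by rewrite -scalemxAr => ->; rewrite scaler0.
move=> Au; have := ccomp_mul (a + d) u hA; rewrite addnK Au => <-.
by apply/colP => r; rewrite !mxE linear0.
Qed.

Lemma image_lift d a b b' (A : 'M[R]_(b, b')) v : hmat d A -> mximage A v -> chomog a v ->
  exists u, v = A *m u /\ chomog (a - d) u.
Proof.
move=> hA [u ->] /ccompP <-; rewrite (ccomp_mul _ _ hA).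
by exists (ccomp (a - d) u); split=> //; apply: chomog_ccomp.
Qed.

Lemma kd_mulmx b b' (A : 'M[R]_(b, b')) c S :
  A *m kd false c S = kd false (fun T => A *m c T : 'cV[R]_b) S.
Proof.
rewrite /kd mulmx_sumr; apply: eq_bigr => i _; rewrite -scalemxAr; congr (_ *: _).
by rewrite /kop /signed; case: ifP; rewrite ?mulmx0 //; case: odd; rewrite ?mulmxN.
Qed.

(** The connecting map of [0 -> ker A -> R^b' -> Z -> 0]: a cycle [c] of the kernel bounds some [g]
    in the free module, [A g] is a cycle of [Z] and so the boundary of some [A u], and [g - kd u] is
    a chain of the kernel with boundary [c]. Applying [A] adds [d] to the degree, and passing from
    [c] to [g] subtracts one. *)
Lemma koszul_van_kernel d b b' (Z : 'cV[R]_b -> Prop) (A : 'M[R]_(b, b')) q a :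
  hmat d A -> (forall v, Z v <-> mximage A v) -> (0 < a)%N ->
  koszul_van Z q.+1 (a + d).-1 -> koszul_van (mxkernel A) q a.
Proof.
move=> hA ZA a_gt0 van c c_ker c_cyc.
have [|//||g [g_a gE]] := @koszul_exact_col k n b' a q c; first by move=> S /c_ker[].
  by rewrite addn_gt0 a_gt0 orbT.
have [S Sq|S [Sq]|w [w_ok wE]] := van (fun S => A *m g S).
- split; first by apply/ZA; exists (g S).
  by rewrite prednK ?addn_gt0 ?a_gt0 //; apply: chomog_mul.
- rewrite -kd_mulmx -gE //; exact: (c_ker S Sq).1.
have lift S : exists u, #|S| = q.+2 -> w S = A *m u /\ chomog a.-1 u.
  have [Sq | nSq] := eqVneq #|S| q.+2; last by exists 0 => e; rewrite e eqxx in nSq.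
  have [/ZA Zw hw] := w_ok S Sq; have [u [-> hu]] := image_lift hA Zw hw.
  by exists u => _; split=> //; rewrite (_ : a.-1 = (a + d).-1 - d)%N //; lia.
have [u u_ok] := fin_all_exists lift.
have card_up S i : i \notin S -> #|flip i S| = #|S|.+1.
  by move=> iS; rewrite card_flip (negPf iS).
exists (fun S => g S - kd false u S); split=> [S Sq | S Sq]; last first.
  by rewrite kdB kd_kd subr0 gE.
split.
  rewrite /mxkernel mulmxBr wE // kd_mulmx -kdB.
  rewrite -[RHS](kd0 _ false S); apply: kd_ext => i; rewrite eqbF_neg => iS.
  have [|-> _] := u_ok (flip i S); first by rewrite card_up // Sq.
  by rewrite subrr.
apply: chomogB => //; rewrite -(prednK a_gt0); apply: kd_chomog => i iS.
by apply: (u_ok _ _).2; rewrite card_up // Sq.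
Qed.

Lemma koszul_van_zero b (Z : 'cV[R]_b -> Prop) q a : Z 0 ->
  (forall v, Z v -> chomog a.+1 v -> v = 0) -> koszul_van Z q a.
Proof.
move=> Z0 Z_a c c_Z _; exists (fun=> 0); split=> [S _ | S Sq].
  by split=> //; apply: chomog0.
by rewrite kd0; have [cZ ca] := c_Z S Sq; apply: Z_a.
Qed.

(** Graded Nakayama: vanishing of the zeroth Koszul homology in degree [a] says that every element
    of [Z] of degree [a] is a combination of elements of degree [a - 1] with the variables as
    coefficients. *)
Lemma image_generated d b b' (Z : 'cV[R]_b -> Prop) (A : 'M[R]_(b, b')) :
  gsubmod Z -> (forall l, Z (col l A)) ->
  (forall v, Z v -> chomog d.+1 v -> mximage A v) ->
  (forall a, a != d -> koszul_van Z 0 a) -> forall v, Z v <-> mximage A v.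
Proof.
move=> [Z0 ZD ZM Zc] A_Z gen_d van v.
have im0 : mximage A 0 by exists 0; rewrite mulmx0.
have imD u w : mximage A u -> mximage A w -> mximage A (u + w).
  by case=> x -> [y ->]; exists (x + y); rewrite mulmxDr.
have imM p u : mximage A u -> mximage A (p *: u).
  by case=> x ->; exists (p *: x); rewrite scalemxAr.
split=> [Zv | [u ->]]; last first.
  rewrite -[A *m u]trmxK trmx_mul mulmx_sum_row linear_sum /=.
  apply: big_ind => // l _; rewrite linearZ /= -tr_col trmxK; exact: ZM.
have hom a w : Z w -> chomog a w -> mximage A w.
  elim: a w => [|a IH] w Zw hw; first by rewrite (chomog_eq0 hw).
  have [e | ne] := eqVneq a d; first by apply: gen_d => //; rewrite -e.
  have [S _ // | // | x [x_ok xE]] := van a ne (fun=> w).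
  rewrite (xE set0) ?cards0 //; apply: big_ind => // i _; apply: (imM).
  rewrite /kop inE eqxx; have [Zx hx] : Z (x (flip i set0)) /\ chomog a (x (flip i set0)).
    by apply: x_ok; rewrite card_flip inE cards0.
  rewrite /signed; case: odd; last exact: IH.
  by rewrite -scaleN1r; apply/imM/IH.
have [K ->] := ccomp_sum v; apply: big_ind => // a _.
by apply: (hom a); [apply: Zc | apply: chomog_ccomp].
Qed.

(** The columns are a basis of the degree [d] part. Their independence excludes constant relations,
    which disposes of degree 0 for the syzygies. *)
Lemma minimal_generators d b (Z : 'cV[R]_b -> Prop) : gsubmod Z ->
  exists b' (A : 'M[R]_(b, b')), [/\ hmat d A, forall l, Z (col l A),
    forall v, Z v -> chomog d.+1 v -> mximage A v
    & forall u, mxkernel A u -> chomog 1 u -> u = 0].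
Proof.
move=> [Z0 ZD ZM Zc].
have [||U UP] := @vspace_of_pred k 'M[k]_(b, size (mons n d.+1)) (fun y => Z (tocol y)).
- by rewrite tocol0.
- by move=> c y z Zy Zz; rewrite tocolP; apply: ZD => //; apply: ZM.
pose A := \matrix_(r < b, l < \dim U) tocol (vbasis U)`_l r 0.
have colA l : col l A = tocol (vbasis U)`_l by apply/colP => r; rewrite !mxE.
have mulA (c : 'I_(\dim U) -> k) :
    A *m (\col_l (c l)%:MP) = tocol (\sum_l c l *: (vbasis U)`_l).
  rewrite tocol_sum; apply/colP => r; rewrite summxE mxE; apply: eq_bigr => l _.
  by rewrite !mxE mulrC.
exists (\dim U), A; split.
- by move=> r l; rewrite mxE; apply/shomogE/chomog_tocol.
- by move=> l; rewrite colA; apply/UP/vbasis_mem/mem_nth; rewrite (size_tuple (vbasis U)).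
- move=> v Zv hv; exists (\col_l (coord (vbasis U) l (fromcol d.+1 v))%:MP).
  rewrite mulA -coord_vbasis ?fromcolK //.
  by apply/UP; rewrite fromcolK.
move=> u Au hu; pose c l := (u l 0)@_0%MM.
have uE : u = \col_l (c l)%:MP.
  apply/colP => l; rewrite mxE; apply/mpolyP => m; rewrite mcoeffC /c.
  have [-> | nz] := eqVneq m 0%MM; first by rewrite mulr1.
  rewrite mulr0; have /shomogP -> // := hu l.
  by move=> [e]; rewrite -mdeg_eq0 e in nz.
have /(congr1 (@fromcol k n d.+1 b)) : A *m u = 0 by [].
rewrite uE mulA tocolK => e.
have {}e : \sum_l c l *: (vbasis U)`_l = 0.
  by rewrite e; apply/matrixP => r j; rewrite !mxE mcoeff0.
have /freeP fr := basis_free (vbasisP U).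
by apply/colP => l; rewrite !mxE (fr c e) mpolyC0.
Qed.

(** [N] counts the linear steps left before the last map. Homology below [N] may live in degree [d]
    only, the [N]-th in degree [top] only, and the next one vanishes, which will make the last map
    injective. *)
Definition koszul_linear N d top b (Z : 'cV[R]_b -> Prop) :=
  [/\ gsubmod Z, forall v, Z v -> chomog 1 v -> v = 0
    & forall q a, [/\ (q < N)%N -> a != d -> koszul_van Z q a,
                      q = N -> a != top -> koszul_van Z q a
                    & q = N.+1 -> koszul_van Z q a]].

(** Degree [a] on the kernel corresponds to degree [a + d - 1] on [Z]: the value [d] gives [a = 1],
    and [top] gives [a = top + 1 - d]. *)
Lemma linear_step N d top b (Z : 'cV[R]_b -> Prop) :
  (0 < d)%N -> koszul_linear N.+1 d top Z ->
  exists b' (A : 'M[R]_(b, b')), [/\ hmat d A, forall v, Z v <-> mximage A v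
    & koszul_linear N 1 (top.+1 - d)%N (mxkernel A)].
Proof.
move=> d_gt0 [gZ Z1 van].
have [b' [A [hA A_Z gen A1]]] := minimal_generators d gZ.
have ZA : forall v, Z v <-> mximage A v.
  apply: (image_generated gZ A_Z gen) => a ne_a.
  by have [h _ _] := van 0%N a; apply: h.
exists b', A; split=> //; split=> //; first exact: gsubmod_kernel hA.
move=> q a; have [a0 | a_gt0] := posnP a.
  by rewrite a0; split=> *; apply: koszul_van_zero => //; rewrite /mxkernel mulmx0.
have [h1 h2 h3] := van q.+1 (a + d).-1.
split=> [lt_q ne | e ne | e]; apply: (koszul_van_kernel hA ZA a_gt0).
- by apply: h1 => //; apply: contra ne => /eqP; lia.
- by apply: h2; [rewrite e | apply: contra ne => /eqP; lia].
- by apply: h3; rewrite e.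
Qed.

(** The kernel has no zeroth Koszul homology in positive degree and no constants, so it is generated
    by the columns of an empty matrix. *)
Lemma last_step d top b (Z : 'cV[R]_b -> Prop) : koszul_linear 0 d top Z ->
  exists b' (A : 'M[R]_(b, b')), [/\ hmat top A, forall v, Z v <-> mximage A v
    & forall v, mxkernel A v -> v = 0].
Proof.
move=> [gZ Z1 van].
have [b' [A [hA A_Z gen A1]]] := minimal_generators top gZ.
have ZA : forall v, Z v <-> mximage A v.
  apply: (image_generated gZ A_Z gen) => a ne_a.
  by have [_ h _] := van 0%N a; apply: h.
exists b', A; split=> // v Kv.
have gK := gsubmod_kernel hA.
have : mximage (0 : 'M[R]_(b', 0)) v.
  apply/(image_generated (d := 0) gK) => // [[] //|u Ku u1|a a0].
    by rewrite (A1 u Ku u1); exists 0; rewrite mulmx0.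
  apply: (koszul_van_kernel hA ZA); first by rewrite lt0n.
  by have [_ _ h] := van 1%N (a + top).-1; apply: h.
by case=> u ->; rewrite mul0mx.
Qed.

End Syzygies.

(** * Hilbert functions *)

(** Here [e i] stands for the dimension of a strand of the [i]-th free module and [r i] for the rank
    of the [i]-th map; exactness turns each nullity into the next rank. *)
Lemma alternating_sum m (e r : nat -> nat) :
  (forall i, (i < m)%N -> (r i.+1 + r i = e i.+1)%N) -> r m = e m.+1 ->
  (e 0%N)%:Z - (r 0%N)%:Z = \sum_(i < m.+2) (-1) ^+ i * (e i)%:Z.
Proof.
move=> e_mid e_last.
have part j : (j <= m)%N ->
    \sum_(i < j.+1) (-1) ^+ i * (e i)%:Z = (e 0%N)%:Z - (r 0%N)%:Z + (-1) ^+ j * (r j)%:Z.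
  elim: j => [_|j IH lt_jm]; first by rewrite big_ord_recl big_ord0 /=; ring.
  rewrite big_ord_recr IH; last exact: ltnW.
  cbn [nat_of_ord ord_max]; rewrite -(e_mid _ lt_jm) PoszD exprS mulN1r mulNr.
  move: ((-1) ^+ j) (Posz (e 0%N)) (Posz (r 0%N)) (Posz (r j)) (Posz (r j.+1)) => x u v w z.
  by rewrite /=; ring.
rewrite big_ord_recr (part m (leqnn m)); cbn [nat_of_ord ord_max].
rewrite -e_last exprS mulN1r mulNr.
move: ((-1) ^+ m) (Posz (e 0%N)) (Posz (r 0%N)) (Posz (r m)) => x u v w.
by rewrite /=; ring.
Qed.

Section HilbertFunction.
Variables (k : fieldType) (n : nat).
Local Notation R := {mpoly k[n]}.

Section GradedMap.
Variables (b b' a a' : nat) (A : 'M[R]_(b, b')).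

Definition graded_map (y : 'M[k]_(b', size (mons n a'))) : 'M[k]_(b, size (mons n a)) :=
  fromcol a (A *m tocol y).

Fact graded_map_is_linear : linear graded_map.
Proof.
move=> c y z; rewrite /graded_map tocolP mulmxDr -scalemxAr.
by rewrite fromcolD fromcolZ.
Qed.
HB.instance Definition _ := GRing.isLinear.Build k
  'M[k]_(b', size (mons n a')) 'M[k]_(b, size (mons n a)) _ graded_map graded_map_is_linear.
End GradedMap.

Section GradedStrand.
Variables (d b b' a : nat) (A : 'M[R]_(b, b')).
Hypothesis hA : hmat d A.
Let L := linfun (@graded_map b b' a (a - d) A).

Lemma tocol_graded_map y : tocol (L y) = A *m tocol y.
Proof.
rewrite lfunE /= /graded_map fromcolK //.
have [lt_ad | le_da] := ltnP a d; last first.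
  by have := chomog_mul hA (chomog_tocol y); rewrite subnK.
have -> : tocol y = 0.
  by have := chomog_tocol y; rewrite {1}(_ : a - d = 0)%N; [move/chomog_eq0 | lia].
by rewrite mulmx0; apply: chomog0.
Qed.

Lemma mem_lker_graded_map y : y \in lker L <-> mxkernel A (tocol y).
Proof.
rewrite memv_ker /mxkernel -tocol_graded_map; split=> [/eqP -> | e].
  exact: tocol0.
by apply/eqP; rewrite -[LHS]tocolK e; apply/matrixP => r j; rewrite !mxE mcoeff0.
Qed.

Lemma mem_limg_graded_map y : y \in limg L <-> mximage A (tocol y).
Proof.
split=> [/memv_imgP[z _ ->] | im_y].
  by rewrite tocol_graded_map; exists (tocol z).
have [u [yE hu]] := image_lift hA im_y (chomog_tocol y).
apply/memv_imgP; exists (fromcol (a - d) u); first exact: memvf.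
by rewrite lfunE /= /graded_map fromcolK // -yE tocolK.
Qed.

End GradedStrand.

Fixpoint twist (d : nat -> nat) (a i : nat) : nat :=
  if i is j.+1 then (twist d a j - d j)%N else a.

Lemma twistE d a i : twist d a i = (a - \sum_(j < i) d j)%N.
Proof.
by elim: i => [|i IH]; rewrite ?big_ord0 ?subn0 // big_ord_recr /= IH subnDA.
Qed.

Lemma dim_columns b a : \dim {: 'M[k]_(b, size (mons n a))} = (b * size (mons n a))%N.
Proof. by rewrite dimvf. Qed.

Lemma euler_characteristic m (d b : nat -> nat) (phi : forall i, 'M[R]_(b i, b i.+1)) a :
  (forall i, (i <= m)%N -> hmat (d i) (phi i)) ->
  (forall i, (i < m)%N -> forall v, mxkernel (phi i) v <-> mximage (phi i.+1) v) ->
  (forall v, mxkernel (phi m) v -> v = 0) ->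
  exists U : {vspace 'M[k]_(b 0%N, size (mons n a))},
    (forall y, y \in U <-> mximage (phi 0%N) (tocol y)) /\
    (b 0%N * size (mons n a))%:Z - (\dim U)%:Z =
    \sum_(i < m.+2) (-1) ^+ i * (b i * size (mons n (twist d a i)))%:Z.
Proof.
move=> hphi exact inj.
pose L i := linfun (@graded_map _ _ (twist d a i) (twist d a i - d i) (phi i)).
pose r i := \dim (limg (L i)).
pose e i := (b i * size (mons n (twist d a i)))%N.
have rank_nullity i : (\dim (lker (L i)) + r i = e i.+1)%N.
  by rewrite /e -dim_columns -(limg_ker_dim (L i) fullv) capfv.
have e_mid i : (i < m)%N -> (r i.+1 + r i = e i.+1)%N.
  move=> lt_im; rewrite -rank_nullity; congr (_ + _)%N; congr (\dim _).
  apply/vspaceP => y; apply/idP/idP.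
    by move/(mem_limg_graded_map (hphi _ lt_im))/(exact _ lt_im)
         /(mem_lker_graded_map (hphi _ (ltnW lt_im))).
  by move/(mem_lker_graded_map (hphi _ (ltnW lt_im)))/(exact _ lt_im)
       /(mem_limg_graded_map (hphi _ lt_im)).
have e_last : r m = e m.+1.
  rewrite -rank_nullity (_ : lker (L m) = 0%VS) ?dimv0 //; apply/eqP.
  rewrite -subv0; apply/subvP => y /(mem_lker_graded_map (hphi _ (leqnn m)))/inj y0.
  rewrite memv0 -[y]tocolK; apply/eqP; rewrite y0.
  by apply/matrixP => ? ?; rewrite !mxE mcoeff0.
exists (limg (L 0%N)); split; first exact: (mem_limg_graded_map (hphi 0%N (leq0n m))).
exact: (alternating_sum e_mid e_last).
Qed.

End HilbertFunction.

(** * Backward differences of Hilbert functions *)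

Section Differences.

Definition bdiff (F : nat -> int) (a : nat) : int := F a - F a.-1.

Lemma eq_iter_bdiff j (F G : nat -> int) : F =1 G -> iter j bdiff F =1 iter j bdiff G.
Proof. by move=> FG; elim: j => //= j IH a; rewrite /bdiff !IH. Qed.

Lemma iter_bdiff_sum j m (c : 'I_m -> int) (F : 'I_m -> nat -> int) a :
  iter j bdiff (fun a => \sum_i c i * F i a) a = \sum_i c i * iter j bdiff (F i) a.
Proof.
elim: j a => //= j IH a; rewrite /bdiff !IH -sumrB.
by apply: eq_bigr => i _; rewrite mulrBr.
Qed.

Lemma iter_bdiff_shift j t (F : nat -> int) a :
  iter j bdiff (fun a => F (a - t)%N) a = iter j bdiff F (a - t)%N.
Proof. by elim: j a => //= j IH a; rewrite /bdiff !IH -!subn1 subnAC. Qed.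

(** For [n = 0] the truncated predecessor still gives the indicator of degree 0, so the [n]-fold
    difference can go down to that case. *)
Definition count_mons n a : int := if a is d.+1 then 'C((d + n).-1, d)%:Z else 0.

Lemma bdiff_count_mons n a : bdiff (count_mons n.+1) a = count_mons n a.
Proof.
case: a => [|[|d]]; first by rewrite /bdiff subrr.
  by rewrite /bdiff /count_mons !bin0 subr0.
change ('C((d.+1 + n.+1).-1, d.+1)%:Z - 'C((d + n.+1).-1, d)%:Z = 'C((d.+1 + n).-1, d.+1)%:Z).
have -> : (d.+1 + n).-1 = (d + n)%N by lia.
have -> : (d.+1 + n.+1).-1 = (d + n).+1 by lia.
have -> : (d + n.+1).-1 = (d + n)%N by lia.
by rewrite binS PoszD addrK.
Qed.

Lemma iter_bdiff_count_mons n a : iter n bdiff (count_mons n) a = (a == 1%N)%:Z.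
Proof.
elim: n a => [|n IH] a; last first.
  by rewrite iterSr (eq_iter_bdiff _ (bdiff_count_mons n)) IH.
by case: a => [|[|d]] //=; rewrite addn0 bin_small.
Qed.

(** Each difference moves the end of the support up by one and negates the value there. *)
Lemma iter_bdiff_top j s (h : nat -> int) :
  (forall a, (s < a)%N -> h a = 0) ->
  (forall a, (s + j < a)%N -> iter j bdiff h a = 0) /\
  iter j bdiff h (s + j)%N = (-1) ^+ j * h s.
Proof.
move=> h0; elim: j => [|j [IH1 IH2]].
  by rewrite addn0; split=> //=; rewrite expr0 mul1r.
split=> [a lt_a|] /=; rewrite /bdiff.
  by rewrite !IH1 ?subr0 //; lia.
by rewrite addnS /= IH1 ?leqnn // IH2 exprS; ring.
Qed.

End Differences.

Lemma size_mons n a : (0 < n)%N -> (size (mons n a))%:Z = count_mons n a.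
Proof.
case: n => // n _; case: a => [|d] //; congr Posz; rewrite addnS -size_basis.
apply/perm_size/uniq_perm; [exact: uniq_mons | exact: uniq_basis |] => u.
by rewrite -basis_cover mem_mons eqSS.
Qed.

(** * Socle degree and twists *)

Section GorensteinIdeal.
Variables (k : fieldType) (n : nat).
Local Notation R := {mpoly k[n]}.
Implicit Types (S T : {set 'I_n}).
Variables (lam : {scalar R}) (s : nat).
Hypothesis lam_s : forall a p, shomog a p -> a <> s.+1 -> lam p = 0.
Hypothesis lam_nz : exists p, lam p != 0.
Local Notation annih := (annih lam).

Lemma annih_big a p : (s.+1 < a)%N -> shomog a p -> annih p.
Proof.
move=> lt_a hp; apply: (annih_test lam_s hp) => q.
by rewrite (_ : s.+2 - a = 0)%N; [move/shomog_eq0->; rewrite mulr0 linear0 | lia].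
Qed.

Lemma shomog1P (q : R) : shomog 1 q -> q = (q@_0%MM)%:MP.
Proof.
move/shomogP => h; apply/mpolyP => m; rewrite mcoeffC.
have [-> | nz] := eqVneq m 0%MM; first by rewrite mulr1.
by rewrite mulr0 h // => -[e]; rewrite -mdeg_eq0 e in nz.
Qed.

Lemma annih_socle p : shomog s.+1 p -> (annih p <-> lam p = 0).
Proof.
move=> hp; split=> [/(_ 1) | p0]; first by rewrite mulr1.
apply: (annih_test lam_s hp) => q; rewrite subSnn => /shomog1P ->.
by rewrite mulrC mul_mpolyC linearZ /= p0 mulr0.
Qed.

Lemma lam_top : exists2 p, shomog s.+1 p & lam p != 0.
Proof.
have [p nz] := lam_nz; exists (scomp s.+1 p); first exact: shomog_scomp.
apply: contraNneq nz => p0; have [K ->] := scomp_sum p.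
rewrite linear_sum big1 // => a _ /=; have [-> // | /eqP ne] := eqVneq (a : nat) s.+1.
exact: lam_s (shomog_scomp _ _) ne.
Qed.

(** In degree [s], I is the kernel of the nonzero functional [lam], hence codimension 1; above, it
    is everything. The row count stays a variable because [b 0 = 1] holds only propositionally for a
    given resolution. *)
Lemma hilbert_annih b a (r : 'I_b) (U : {vspace 'M[k]_(b, size (mons n a))}) : b = 1%N ->
  (forall y, y \in U <-> annih (tocol y r 0)) ->
  ((s.+1 < a)%N -> (b * size (mons n a))%:Z - (\dim U)%:Z = 0) /\
  (a = s.+1 -> (b * size (mons n a))%:Z - (\dim U)%:Z = 1).
Proof.
move=> b1; subst b => UE; rewrite -(@dim_columns k n 1 a); split=> [lt_a | as1].
  rewrite (_ : U = fullv) ?subrr //; apply/vspaceP => y; rewrite memvf.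
  by apply/UE/(annih_big lt_a)/chomog_tocol.
subst a; pose f (y : 'M[k]_(1, size (mons n s.+1))) : k^o := lam (tocol y r 0).
have f_lin : linear f.
  by move=> c y z; rewrite /f tocolP !mxE linearD mul_mpolyC linearZ.
pose F := GRing.isLinear.Build k _ k^o _ f f_lin.
pose fL : {linear 'M[k]_(1, size (mons n s.+1)) -> k^o} := HB.pack f F.
pose L := linfun fL.
have kerL : lker L = U.
  apply/vspaceP => y; rewrite memv_ker lfunE /=; apply/idP/idP => [/eqP h | /UE h].
    by apply/UE/annih_socle => //; apply: chomog_tocol.
  by apply/eqP/annih_socle => //; apply: chomog_tocol.
have : \dim (limg L) = 1%N.
  apply/eqP; rewrite eqn_leq; apply/andP; split.
    by apply: leq_trans (dimvS (subvf _)) _; rewrite dimvf.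
  rewrite lt0n dimv_eq0; have [p hp nz] := lam_top; apply: contra nz => /eqP L0.
  pose y := fromcol s.+1 (const_mx p : 'cV[R]_1).
  have : L y \in limg L by apply/memv_img/memvf.
  rewrite L0 memv0 lfunE /= /f fromcolK ?mxE // => i; by rewrite mxE.
have := limg_ker_dim L fullv; rewrite capfv kerL => <- ->.
by rewrite PoszD addrAC subrr add0r.
Qed.

(* With [h] the Hilbert function of the quotient, [Delta^n h] is read off on the
   one side from the socle degree and on the other side from the twists. *)
Lemma last_betti m (d b : nat -> nat) (phi : forall i, 'M[R]_(b i, b i.+1)) :
  (m.+1 = n)%N -> b 0%N = 1%N -> (0 < d m)%N ->
  (forall i, (i <= m)%N -> hmat (d i) (phi i)) ->
  (forall i, (i < m)%N -> forall v, mxkernel (phi i) v <-> mximage (phi i.+1) v) ->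
  (forall v, mxkernel (phi m) v -> v = 0) ->
  (forall p, annih p <-> exists w : 'cV[R]_(b 1%N), forall r, p = (phi 0%N *m w) r ord0) ->
  (b n = 1%N -> \sum_(j < n) d j = s + n)%N /\
  (\sum_(j < n) d j = s + n -> b n = 1)%N.
Proof.
move=> mn b0 dm hphi exact inj im0; pose sh i := (\sum_(j < i) d j)%N.
have r0 : 'I_(b 0%N) by rewrite b0; exact: ord0.
have all_r (r : 'I_(b 0%N)) : r = r0.
  by apply/val_inj; have := ltn_ord r; have := ltn_ord r0; rewrite /= {2 4}b0; lia.
pose h a : int := \sum_(i < m.+2) (-1) ^+ i * (b i)%:Z * count_mons n (a - sh i)%N.
have hE a : ((s.+1 < a)%N -> h a = 0) /\ (a = s.+1 -> h a = 1).
  have [U [UE hUE]] := euler_characteristic a hphi exact inj.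
  have UE' y : y \in U <-> annih (tocol y r0 0).
    split=> [/UE[w yE] | /im0[w wE]].
      by apply/im0; exists w => r; rewrite (all_r r) yE.
    apply/UE; exists w; apply/colP => r; rewrite (all_r r) (wE r0).
    by congr (_ r0 _); apply/val_inj.
  have -> : h a = (b 0%N * size (mons n a))%:Z - (\dim U)%:Z; last first.
    exact: hilbert_annih b0 UE'.
  rewrite hUE; apply: eq_bigr => i _.
  by rewrite twistE PoszM size_mons -?mn // mulrA.
have diffE a : iter n bdiff h a = \sum_(i < m.+2) (-1) ^+ i * (b i)%:Z * ((a - sh i)%N == 1%N)%:Z.
  rewrite iter_bdiff_sum; apply: eq_bigr => i _.
  by rewrite iter_bdiff_shift iter_bdiff_count_mons.
have [above top] := iter_bdiff_top n (fun a => (hE a).1).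
rewrite (hE _).2 // mulr1 in top.
have sh_lt i : (i < m.+1)%N -> (sh i < sh m.+1)%N.
  rewrite /sh big_ord_recr /= ltnS => le_im.
  rewrite -addn1 leq_add // (big_ord_widen _ d le_im) [leqRHS](bigID (fun j : 'I_m => (j < i)%N)) /=.
  exact: leq_addr.
(* Above [sh n] every earlier twist is at least two steps behind, so only the last free module
   contributes. *)
have diff_n a : (sh n < a)%N -> iter n bdiff h a = (-1) ^+ n * (b n)%:Z * ((a - sh n)%N == 1%N)%:Z.
  move=> lt_a; rewrite diffE big_ord_recr big1 /= ?add0r -?mn // => i _.
  have lt_i : (sh i < sh n)%N by rewrite -mn; apply: sh_lt.
  rewrite (_ : _ == 1%N = false) ?mulr0 //; apply/eqP; lia.
have sgn_nz : (-1) ^+ n != 0 :> int by rewrite signr_eq0.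
(* Otherwise the last module contributes 0 at [s.+1 + n], where the difference is a sign. *)
have sh_ge : (s + n <= sh n)%N.
  rewrite leqNgt; apply/negP => lt_sh; have := diff_n (s.+1 + n)%N.
  rewrite top (_ : _ == 1%N = false) ?mulr0; last by apply/eqP; lia.
  by move=> /(_ ltac:(lia))/eqP; rewrite (negPf sgn_nz).
rewrite -/(sh n); split=> [bn | e].
  (* Just above a larger [sh n] the difference would be a sign, although it vanishes beyond
     [s.+1 + n]. *)
  apply/eqP; rewrite eqn_leq sh_ge andbT leqNgt; apply/negP => lt_s.
  have := diff_n (sh n).+1 (leqnn _); rewrite above; last by lia.
  rewrite bn subSnn eqxx !mulr1 => /esym/eqP; by rewrite (negPf sgn_nz).
have := diff_n (s.+1 + n)%N; rewrite top e addSn subSnn eqxx mulr1.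
move=> /(_ (leqnn _))/eqP; rewrite -{1}[_ ^+ n]mulr1 (inj_eq (mulfI sgn_nz)).
by move=> /eqP[].
Qed.

End GorensteinIdeal.

(** * Existence of the linear resolution *)

(** For [n = 1] the first and the last map coincide and [d] would be counted once. *)
Lemma sum_lin_res_deg n d : (2 <= n)%N ->
  (\sum_(j < n) lin_res_deg n d j = d.*2 + n - 2)%N.
Proof.
case: n => [|[|n]] // _; rewrite big_ord_recl big_ord_recr /= /lin_res_deg /= eqxx.
rewrite (eq_bigr (fun=> 1%N)) => [|i _].
  by rewrite sum_nat_const card_ord; lia.
by have := ltn_ord i; rewrite /bump /= add1n eqSS => /ltn_eqF ->.
Qed.

Section LinearResolution.
Variables (k : fieldType) (n : nat).
Local Notation R := {mpoly k[n]}.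
Implicit Types (S T : {set 'I_n}).
Variables (lam : {scalar R}) (s : nat).
Hypothesis lam_s : forall a p, shomog a p -> a <> s.+1 -> lam p = 0.
Hypothesis lam_nz : exists p, lam p != 0.
Hypothesis n_ge2 : (2 <= n)%N.
Local Notation annih := (annih lam).

Definition annih_col (v : 'cV[R]_1) := annih (v 0 0).

Lemma gsubmod_annih : gsubmod annih_col.
Proof.
split=> [|u v|p u|a u]; rewrite /annih_col ?mxE.
- exact: annih0.
- exact: annihD.
- exact: annihM.
- exact: (annih_scomp lam_s).
Qed.

Lemma kd_entry b (c : {set 'I_n} -> 'cV[R]_b) r S :
  kd false c S r 0 = kdr false (fun T => c T r 0) S.
Proof.
rewrite kdrE summxE; apply: eq_bigr => i _; rewrite mxE; congr (_ * _).
by rewrite /kop /signed; do 2?case: ifP => _; rewrite ?mxE.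
Qed.

(** A cycle of I bounds some [p] over [R], and [p] is a cycle of A one homological degree higher and
    one degree lower; [koszul_dual] corrects [p] by a boundary so that it lies in I. *)
Lemma koszul_van_annih t q a :
  (forall d p, (d <= t.+1)%N -> shomog d p -> annih p -> p = 0) ->
  (q.+1 < n)%N -> (t.+1 < a)%N -> (s < a.-1 + t)%N -> koszul_van annih_col q a.
Proof.
move=> low lt_qn lt_ta lt_s c c_ann c_cyc.
have [S /c_ann[] //|//||p [p_a pE]] := @koszul_exact_col k n 1 a q c; first by lia.
have [||S Sq|S [Sq]|w [w_a wE]] :=
  koszul_dual lam_s (q := q.+1) (a := a.-1) (c := fun S => p S 0 0) low => //.
- by rewrite prednK; [apply: p_a | lia].
- by rewrite -kd_entry -pE //; exact: (c_ann S Sq).1.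
exists (fun S => p S - kd false (fun T => const_mx (w T)) S); split=> [S Sq | S Sq]; last first.
  by rewrite kdB kd_kd subr0 pE.
split.
  rewrite /annih_col !mxE kd_entry; have := wE S Sq; congr (annih (_ - _)).
  by rewrite !kdrE; apply: eq_bigr => i _; congr (_ * _); apply: kop_ext; rewrite mxE.
apply: chomogB => //; rewrite -(prednK (_ : 0 < a)%N); last by lia.
by apply: kd_chomog => i _ r; rewrite mxE.
Qed.

(** Here [p] is a single form at the full set, and each ['X_i * p] lies in I. So [lam (p q)] depends
    only on the constant term of [q], and [lam p = 0] because [p] has degree [a - 1], not [s]. *)
Lemma koszul_van_annih_top a : (0 < a)%N -> a != s.+1 -> koszul_van annih_col n.-1 a.
Proof.
move=> a_gt0 ne_a c c_ann c_cyc.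
have [S /c_ann[] //|//||p [p_a pE]] := @koszul_exact_col k n 1 a n.-1 c; first by lia.
exists p; split=> // S; rewrite prednK => [Sn|]; last by lia.
split=> //; have {Sn} ST : S = setT.
  by apply/eqP; rewrite eqEcard subsetT cardsT card_ord Sn leqnn.
have Xp i : annih ('X_i * p S 0 0).
  have iS : i \in S by rewrite ST inE.
  have card_i : #|S :\ i| = n.-1.
    by have := cardsD1 i S; rewrite iS add1n {1}ST cardsT card_ord => /(congr1 predn)/esym.
  have [] := c_ann _ card_i; rewrite /annih_col pE // kd_entry kdrE.
  rewrite (bigD1 i) //= big1 ?addr0 => [|j ne_ji]; last first.
    by rewrite /kop !inE ne_ji ST inE mulr0.
  rewrite /kop !inE eqxx /= (_ : flip i (S :\ i) = S); last first.
    by rewrite /flip !inE eqxx /= setD1K.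
  rewrite /signed; case: odd => // h _; rewrite -[p S 0 0]opprK mulrN -mulN1r.
  exact: annihM.
move=> q; rewrite (mpolyE q) mulr_sumr linear_sum big1 // => m _.
rewrite /= -scalerAr linearZ /= [lam _](_ : _ = 0) ?mulr0 //.
have [-> | nz_m] := eqVneq m 0%MM.
  by rewrite mpolyX0 mulr1; apply: (lam_s (p_a S 0)); apply/eqP.
have [i m_i] : exists i, m i != 0%N.
  apply/existsP; apply: contraNT nz_m; rewrite negb_exists => /forallP h0.
  by apply/eqP/mnmP => i; rewrite mnm0E; have := h0 i; rewrite negbK => /eqP.
rewrite -(submK (_ : (U_(i) <= m)%MM)) ?lep1mP // mpolyXD mulrA mulrAC [p S 0 0 * _]mulrC.
exact: Xp.
Qed.

Section EvenSocle.
Variable t : nat.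
Hypothesis s_even : s = t.*2.
Hypothesis low : forall d p, (d <= t.+1)%N -> shomog d p -> annih p -> p = 0.

Lemma annih_col_low a v : (a <= t.+1)%N -> annih_col v -> chomog a v -> v = 0.
Proof.
move=> le_a v_ann hv; apply/colP => r; rewrite mxE ord1.
exact: (low le_a (hv 0)).
Qed.

Lemma koszul_linear_annih : koszul_linear n.-1 t.+1 s.+1 annih_col.
Proof.
have [Z0 _ _ _] := gsubmod_annih.
split=> [|v|q a]; first exact: gsubmod_annih.
  exact: annih_col_low.
have zero_low : (a <= t)%N -> koszul_van annih_col q a.
  by move=> le_a; apply: koszul_van_zero => // v; apply: annih_col_low.
split=> [lt_q ne_a | -> ne_a | qn].
- have [/zero_low // | lt_ta] := leqP a t.
  by apply: (koszul_van_annih low) => //; lia.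
- have [a0 | a_gt0] := posnP a; last exact: koszul_van_annih_top.
  by rewrite a0; apply: koszul_van_zero => // v; apply: annih_col_low.
move=> c c_ann c_cyc.
have [S /c_ann[] //|//||w [_ wE]] := @koszul_exact_col k n 1 a q c; first by lia.
exists w; split=> // S Sq; have := max_card (mem S).
by rewrite card_ord Sq; lia.
Qed.

(** The ranks are found only while the resolution is built, so the iterated state carries its own
    rank. *)
Definition column_module := {b : nat & 'cV[R]_b -> Prop}.

Definition resolution_stage i (x : column_module) :=
  if (i < n)%N then
    koszul_linear (n.-1 - i) (if i == 0 then t.+1 else 1)%N
      (if i == 0 then s.+1 else t.+1)%N (projT2 x)
  else forall v, projT2 x v -> v = 0.

Definition presents i (x y : column_module) (A : 'M[R]_(projT1 x, projT1 y)) :=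
  [/\ hmat (lin_res_deg n t.+1 i) A, forall v, projT2 x v <-> mximage A v
    & forall v, projT2 y v <-> mxkernel A v].

Lemma resolution_step i x : (i < n)%N -> resolution_stage i x ->
  exists y, (exists A, @presents i x y A) /\ resolution_stage i.+1 y.
Proof.
move=> lt_in; rewrite /resolution_stage lt_in /presents /lin_res_deg.
have [lt_i1n | ge_i1n] := ltnP i.+1 n.
  rewrite (_ : n.-1 - i = (n.-1 - i.+1).+1)%N; last by lia.
  case/linear_step => [|b' [A [hA xA lin]]]; first by case: ifP.
  exists (existT _ b' (mxkernel A)); split; first (exists A; split=> //).
    by move: hA; case: eqP => // _; rewrite (_ : i == n.-1 = false) //; apply/eqP; lia.
  move: lin; rewrite /= (_ : (_.+1 - _)%N = t.+1) //; case: eqP => _; lia.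
rewrite (_ : n.-1 - i = 0)%N; last by lia.
rewrite (_ : i == 0%N = false); last by apply/eqP; lia.
case/last_step => b' [A [hA xA inj]].
exists (existT _ b' (mxkernel A)); split=> //; exists A; split=> //.
by rewrite (_ : i == n.-1) //; apply/eqP; lia.
Qed.

Lemma linear_resolution : has_linear_gor_resolution annih t.+1.
Proof.
(* Iterating a choice requires a step defined on every state; where the hypotheses fail, any state
   will do. *)
have total i (x : column_module) : exists y, (i < n)%N -> resolution_stage i x ->
    (exists A, @presents i x y A) /\ resolution_stage i.+1 y.
  have [[lt_in st] | no] := classic ((i < n)%N /\ resolution_stage i x).
    by have [y hy] := resolution_step lt_in st; exists y.
  by exists x => lt_in st; case: no.
pose next i x := proj1_sig (constructive_indefinite_description _ (total i x)).
have nextP i x := proj2_sig (constructive_indefinite_description _ (total i x)).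
pose st := fix st i := if i is j.+1 then next j (st j) else existT _ 1%N annih_col : column_module.
have stage i : (i <= n)%N -> resolution_stage i (st i).
  elim: i => [_|i IH lt_in]; last by apply: (nextP i (st i) lt_in (IH (ltnW lt_in))).2.
  by rewrite /resolution_stage (ltn_trans _ n_ge2) // subn0; apply: koszul_linear_annih.
have exA i : exists A, (i < n)%N -> @presents i (st i) (st i.+1) A.
  have [lt_in | le_ni] := ltnP i n; last by exists 0.
  by have [[A hA] _] := nextP i (st i) lt_in (stage i (ltnW lt_in)); exists A.
pose phi i := proj1_sig (constructive_indefinite_description _ (exA i)).
have phiP i : (i < n)%N -> presents i (phi i) :=
  proj2_sig (constructive_indefinite_description _ (exA i)).
pose b i := projT1 (st i).
have n1 : (n.-1.+1 = n)%N by lia.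
have exact i : (i < n.-1)%N -> forall v : 'cV[R]_(b i.+1), mxkernel (phi i) v <-> mximage (phi i.+1) v.
  move=> lt_i v; have [_ _ kerE] := phiP i ltac:(lia).
  have [_ imE _] := phiP i.+1 ltac:(lia).
  by split=> [/kerE/imE | /imE/kerE].
have inj (v : 'cV[R]_(b n.-1.+1)) : mxkernel (phi n.-1) v -> v = 0.
  have [_ _ kerE] := phiP n.-1 ltac:(lia); move/kerE.
  have le_n1 : (n.-1.+1 <= n)%N by rewrite n1.
  have lt_n1 : (n.-1.+1 < n)%N = false by rewrite n1 ltnn.
  by have := stage _ le_n1; rewrite /resolution_stage lt_n1 => h /h.
have gens p : annih p <-> exists w : 'cV[R]_(b 1%N), forall r : 'I_(b 0%N), p = (phi 0%N *m w) r ord0.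
  have [_ imE _] := phiP 0%N ltac:(lia); split=> [p_ann | [w pE]].
    have /imE[w wE] : annih_col (const_mx p) by rewrite /annih_col mxE.
    by exists w => r; rewrite -wE mxE.
  have : annih_col (phi 0%N *m w) by apply/imE; exists w.
  by rewrite /annih_col -(pE 0).
have deg_gt0 i : (0 < lin_res_deg n t.+1 i)%N by rewrite /lin_res_deg; do 2?case: ifP.
(* The entry degrees sum to [2(t+1) + n - 2 = s + n], which forces the last rank. *)
have bn : b n = 1%N.
  apply: (last_betti lam_s lam_nz n1 _ (deg_gt0 n.-1) _ exact inj gens).2 => //.
    by move=> i le_i; have [] := phiP i ltac:(lia).
  by rewrite sum_lin_res_deg // s_even; lia.
exists b, phi; split=> // [i lt_in r c | i lt_in v].
  have [hA _ _] := phiP i lt_in; split; first exact: hA.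
  have /shomogE/shomogP -> // := hA r c.
  rewrite (_ : [multinom _ | l < n] = 0%MM) ?mdeg0; last first.
    by apply/mnmP => l; rewrite !mnmE.
  by have := deg_gt0 i; lia.
by apply: exact; lia.
Qed.

End EvenSocle.

End LinearResolution.

(** * The colon ideal and the coefficient matrix *)

Lemma mpolyX_neq0 (k : fieldType) n (u : 'X_{1..n}) : 'X_[u] != 0 :> {mpoly k[n]}.
Proof.
by apply/eqP => /(congr1 (mcoeff u))/eqP; rewrite mcoeffX eqxx mcoeff0 oner_eq0.
Qed.

(** * What a linear resolution forces on the socle degree *)

Section LinearResolutionInverse.
Variables (k : fieldType) (n : nat).
Local Notation R := {mpoly k[n]}.
Variables (lam : {scalar R}) (s : nat).
Hypothesis lam_s : forall a p, shomog a p -> a <> s.+1 -> lam p = 0.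
Hypothesis lam_nz : exists p, lam p != 0.
Hypothesis n_ge2 : (2 <= n)%N.
Local Notation annih := (annih lam).

Lemma annih_proper : exists2 p, annih p & p != 0.
Proof.
have i : 'I_n by exists 0%N; lia.
exists 'X_[U_(i) *+ s.+1]; last exact: mpolyX_neq0.
apply: (annih_big lam_s (ltnSn s.+1)); apply/shomogP => u ne.
rewrite mcoeffX; case: eqP => // e; case: ne.
by rewrite -e mdegMn mdeg1 mul1n.
Qed.

(** If [d = 0], minimality makes the first map zero, against [annih_proper]. Then last rank 1 gives
    [2d + n - 2 = s + n], and generators of degree [d] leave nothing of degree [d - 1] in I. *)
Lemma linear_resolution_inv d : has_linear_gor_resolution annih d ->
  [/\ (0 < d)%N, s = d.-1.*2, forall p, shomog d p -> annih p -> p = 0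
    & generated_in_degree annih d].
Proof.
case=> b [phi [[b0 bn] ent gens ex inj]].
have hphi i : (i < n)%N -> hmat (lin_res_deg n d i) (phi i).
  by move=> lt_in r c; have [] := ent i lt_in r c.
have r0 : 'I_(b 0%N) by rewrite b0; exact: ord0.
have all_r (r : 'I_(b 0%N)) : r = r0.
  by apply/val_inj; have := ltn_ord r; have := ltn_ord r0; rewrite /= {2 4}b0; lia.
have hphi0 : hmat d (phi 0%N) by apply: (hphi 0%N); lia.
have d_gt0 : (0 < d)%N.
  rewrite lt0n; apply/eqP => d0.
  have [p /gens[w pE] /eqP[]] := annih_proper; rewrite (pE r0) mxE big1 // => c _.
  suff -> : phi 0%N r0 c = 0 by rewrite mul0r.
  have [|_ c0] := ent 0%N _ r0 c; first by lia.
  have := hphi0 r0 c; rewrite d0 => /shomogE/shomog1P->.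
  by rewrite -[RHS]mpolyC0 -c0; congr ((_@_ _)%:MP); apply/mnmP => l; rewrite !mnmE.
have n1 : (n.-1.+1 = n)%N by lia.
have last_deg : (0 < lin_res_deg n d n.-1)%N.
  by rewrite /lin_res_deg eqxx; do 2?case: ifP.
have [sumE _] := last_betti lam_s lam_nz n1 b0 last_deg
  (fun i (h : (i <= n.-1)%N) => hphi i ltac:(lia)) (fun i h => ex i ltac:(lia)) inj gens.
have := sumE bn; rewrite sum_lin_res_deg // => sE.
split=> //; first by lia.
- move=> p hp /gens[w pE].
  have hv : chomog d (phi 0%N *m w) by move=> r; rewrite (all_r r) -[X in shomog _ X](pE r0).
  have [|u [vE]] := image_lift hphi0 _ hv; first by exists w.
  rewrite subnn => /chomog_eq0 u0; rewrite (pE r0) vE u0 mulmx0 mxE //.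
exists (b 1%N), (phi 0%N r0); split=> [j|p]; first exact: hphi0.
split=> [/gens[w pE] | [c ->]].
  by exists (fun j => w j 0); rewrite (pE r0) mxE; apply: eq_bigr => j _; rewrite mulrC.
apply/gens; exists (\col_j c j) => r; rewrite (all_r r) mxE.
by apply: eq_bigr => j _; rewrite mxE mulrC.
Qed.

End LinearResolutionInverse.

Lemma has_linear_gor_resolution_ext (k : fieldType) n (I J : {mpoly k[n]} -> Prop) d :
  (forall p, I p <-> J p) -> has_linear_gor_resolution I d -> has_linear_gor_resolution J d.
Proof.
move=> IJ [b [phi [h1 h2 h3 h4 h5]]]; exists b, phi; split=> // p.
by rewrite -IJ; apply: h3.
Qed.

Lemma full_rank_minorP (k : fieldType) r c (A : 'M[k]_(r, c)) :
  (exists (rs : 'I_c -> 'I_r) (cs : 'I_c -> 'I_c), \det (mxsub rs cs A) != 0) <->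
  \rank A = c.
Proof.
split=> [[rs [cs nz]] | rk].
  apply/eqP; rewrite eqn_leq rank_leq_col /=.
  have /mxrank_unit {1}<- : mxsub rs cs A \in unitmx by rewrite unitmxE unitfE.
  rewrite -(mxrank_tr A) -(mxrank_tr (mxsub _ _ _)).
  have -> : (mxsub rs cs A)^T = rowsub cs (colsub rs A^T) by apply/matrixP => i j; rewrite !mxE.
  apply: leq_trans (mxrankS (rowsub_sub _ _)) _; rewrite -mxrank_tr -[leqRHS]mxrank_tr.
  have -> : (colsub rs A^T)^T = rowsub rs A by apply/matrixP => i j; rewrite !mxE.
  by rewrite trmxK; apply/mxrankS/rowsub_sub.
have fA : row_full A by rewrite /row_full rk.
exists (fullrankfun fA), id; have := fullrowsub_unit fA.
by rewrite unitmxE unitfE.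
Qed.

Lemma rank_eq_ncols (k : fieldType) r c (A : 'M[k]_(r, c)) :
  \rank A = c <-> (forall y : 'cV[k]_c, A *m y = 0 -> y = 0).
Proof.
have -> : \rank A = c <-> row_free A^T.
  by rewrite /row_free mxrank_tr; split=> [-> | /eqP].
rewrite -kermx_eq0; split=> [/rowV0P h y Ay | h].
  apply: trmx_inj; rewrite trmx0; apply/h/sub_kermxP.
  by rewrite -trmx_mul Ay trmx0.
apply/rowV0P => v /sub_kermxP vA; apply: trmx_inj; rewrite trmx0; apply: h.
by rewrite -[A]trmxK -trmx_mul vA trmx0.
Qed.

Lemma card_expT n t : (0 < n)%N -> #|{: expT n t}| = 'C(t + n - 1, n - 1).
Proof.
move=> n_gt0; have [] : Posz #|{: expT n t}| = Posz 'C(t + n - 1, n - 1); last by [].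
have := size_mons t.+1 n_gt0; rewrite /= size_map -cardE => ->.
by congr Posz; rewrite -bin_sub ?subn1; [congr binomial|]; lia.
Qed.

(** * The functional attached to [f] and the colon ideal *)

Section ColonIdeal.
Variables (k : fieldType) (n m e : nat) (f : {mpoly k[n]}).
Local Notation R := {mpoly k[n]}.

Lemma in_powers_idealP (p : R) :
  in_powers_ideal m p <-> (forall u : 'X_{1..n}, (forall i, (u i < m)%N) -> p@_u = 0).
Proof.
split=> [[c ->] u lt_u | h].
  rewrite raddf_sum big1 // => i _; rewrite /= mpolyXn mcoeffMXE.
  case: ifP => // /mnm_lepP/(_ i); rewrite mulmnE mnm1E eqxx mul1n.
  by rewrite leqNgt lt_u.
rewrite (mpolyE p); apply: (big_ind (fun q => in_powers_ideal m q)).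
- by exists (fun=> 0); rewrite big1 // => i _; rewrite mul0r.
- move=> _ _ [c ->] [c' ->]; exists (fun i => c i + c' i); rewrite -big_split.
  by apply: eq_bigr => i _; rewrite mulrDl.
move=> u _; have [/existsP[i le_i] | ] := boolP [exists i, (m <= u i)%N]; last first.
  rewrite negb_exists => /forallP lt_u; rewrite h => [|i]; last by rewrite ltnNge.
  by exists (fun=> 0); rewrite scale0r big1 // => i _; rewrite mul0r.
exists (fun j => if j == i then p@_u *: 'X_[u - U_(i) *+ m] else 0).
rewrite (bigD1 i) //= eqxx big1 ?addr0 => [|j /negPf->]; last by rewrite mul0r.
rewrite mpolyXn -scalerAl -mpolyXD submK //; apply/mnm_lepP => j.
by rewrite mulmnE mnm1E; case: eqP => [<-|_]; rewrite ?mul1n.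
Qed.

Lemma in_powers_idealM (p q : R) : in_powers_ideal m p -> in_powers_ideal m (p * q).
Proof.
case=> c ->; exists (fun i => c i * q); rewrite mulr_suml.
by apply: eq_bigr => i _; rewrite mulrAC.
Qed.

Hypothesis m_gt0 : (0 < m)%N.
Definition top_mon : 'X_{1..n} := [multinom m.-1 | i < n].

Lemma mdeg_top : mdeg top_mon = (n * m.-1)%N.
Proof.
rewrite mdegE (eq_bigr (fun=> m.-1)) ?sum_nat_const ?card_ord // => i _.
exact: mnmE.
Qed.

Lemma le_top (u : 'X_{1..n}) : (u <= top_mon)%MM <-> (forall i, (u i < m)%N).
Proof.
split=> [/mnm_lepP h i | h]; first by have := h i; rewrite mnmE; lia.
by apply/mnm_lepP => i; rewrite mnmE; have := h i; lia.
Qed.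

Definition socle_form (p : R) : k^o := (p * f)@_top_mon.
Fact socle_form_is_linear : linear socle_form.
Proof.
by move=> c p q; rewrite /socle_form mulrDl -scalerAl mcoeffD mcoeffZ.
Qed.
HB.instance Definition _ := GRing.isLinear.Build k R k^o _ socle_form socle_form_is_linear.

(** Complementary monomials move each coefficient that survives modulo the powers to the top corner;
    hence [annih] sees all of them. *)
Lemma socle_formX p (u : 'X_{1..n}) : (u <= top_mon)%MM ->
  socle_form (p * 'X_[top_mon - u]) = (p * f)@_u.
Proof.
move=> le_u; by rewrite /socle_form mulrAC -{1}(submK le_u) mcoeffMX.
Qed.

Lemma annih_socle_form p : annih socle_form p <-> in_colon m f p.
Proof.
split=> [h | h q]; first by apply/in_powers_idealP => u /le_top le_u; rewrite -socle_formX.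
rewrite /= /socle_form mulrAC; move/in_powers_idealP: (in_powers_idealM q h); apply.
exact/le_top/lepm_refl.
Qed.

Hypothesis f_hom : f \is e.-homog.
Hypothesis f_out : ~ in_powers_ideal m f.

Lemma witness_monomial : exists2 u : 'X_{1..n}, (u <= top_mon)%MM & f@_u != 0.
Proof.
apply: NNPP => no; apply/f_out/in_powers_idealP => u /le_top le_u.
by apply/eqP/negPn/negP => nz; apply: no; exists u.
Qed.

(** This makes the truncated subtraction that defines [s] an honest one. *)
Lemma deg_le_top : (e <= n * m.-1)%N.
Proof.
have [u /mnm_lepP le_u nz] := witness_monomial.
rewrite -(_ : mdeg u = e); last first.
  by apply/eqP; apply: contraR nz => ne; rewrite (dhomog_nemf_coeff f_hom ne).
by rewrite -mdeg_top !mdegE; apply: leq_sum => i _.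
Qed.

Lemma socle_form_degree a p : shomog a p -> a <> (n * m.-1 - e).+1 -> socle_form p = 0.
Proof.
move=> hp ne; have /shomogP h := shomogM f_hom hp.
rewrite /socle_form mulrC h // mdeg_top => e1; apply: ne.
by have := deg_le_top; lia.
Qed.

Lemma socle_form_neq0 : exists p, socle_form p != 0.
Proof.
have [u le_u nz] := witness_monomial.
by exists (1 * 'X_[top_mon - u]); rewrite socle_formX // mul1r.
Qed.

End ColonIdeal.

(** * The matrix as multiplication by [f] *)

Section CoefficientMatrix.
Variables (k : fieldType) (n m e : nat) (f : {mpoly k[n]}).
Local Notation R := {mpoly k[n]}.

Definition row_mon t (g : rowT n m t) : 'X_{1..n} := [multinom (val g i : nat) | i < n].

Lemma Mmat_entry t i j : Mmat e t m f i j =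
  (f * 'X_[mono_of (enum_val j : expT n t)])@_(row_mon (enum_val i : rowT n m (e + t))).
Proof.
rewrite mxE /=; set g := enum_val i; set b := enum_val j; rewrite mcoeffMXE.
case: pickP => [a /forallP ab | none].
  have -> : row_mon g = (mono_of a + mono_of b)%MM.
    by apply/mnmP => l; rewrite mnmDE !mnmE; apply/esym/eqP/ab.
  by rewrite lem_addl addmK.
case: ifP => // le_bg.
have deg_gb : mdeg (row_mon g - mono_of b)%MM = e.
  have := congr1 mdeg (submK le_bg); rewrite mdegD mdeg_mono_of.
  rewrite [mdeg (row_mon g)]mdegE (eq_bigr (fun l => val g l : nat)) => [|l _]; last exact: mnmE.
  by rewrite (eqP (valP g)); lia.
have [a aE] := mono_of_surj deg_gb.
have /forallP[] := none a; move=> l; move/mnmP/(_ l): aE; rewrite mnmBE !mnmE => ->.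
by rewrite subnK //; have /mnm_lepP/(_ l) := le_bg; rewrite !mnmE.
Qed.

Definition poly_of t (y : 'cV[k]_#|{: expT n t}|) : R :=
  \sum_j y j 0 *: 'X_[mono_of (enum_val j : expT n t)].

Lemma poly_of_homog t (y : 'cV[k]_#|{: expT n t}|) : poly_of y \is t.-homog.
Proof.
by apply: rpred_sum => j _; apply/rpredZ; rewrite dhomogX /= mdeg_mono_of.
Qed.

Lemma mcoeff_poly_of t (y : 'cV[k]_#|{: expT n t}|) (b : expT n t) : (poly_of y)@_(mono_of b) = y (enum_rank b) 0.
Proof.
rewrite raddf_sum (bigD1 (enum_rank b)) //= enum_rankK mcoeffZ mcoeffX eqxx mulr1.
rewrite big1 ?addr0 // => j ne; rewrite mcoeffZ mcoeffX.
by rewrite (inj_eq (@mono_of_inj n t)) (can2_eq (@enum_valK _) (@enum_rankK _)) (negPf ne) mulr0.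
Qed.

Lemma poly_of_surj t p : p \is t.-homog ->
  exists y, p = poly_of (t := t) y.
Proof.
move=> hp; exists (\col_j p@_(mono_of (enum_val j))); apply/mpolyP => u.
have [ut | ne] := eqVneq (mdeg u) t; last first.
  by rewrite (dhomog_nemf_coeff hp ne) (dhomog_nemf_coeff (poly_of_homog _) ne).
have [b <-] := mono_of_surj ut.
by rewrite mcoeff_poly_of mxE enum_rankK.
Qed.

Lemma Mmat_mul t (y : 'cV[k]_#|{: expT n t}|) i :
  (Mmat e t m f *m y) i 0 = (poly_of y * f)@_(row_mon (enum_val i : rowT n m (e + t))).
Proof.
rewrite mxE /poly_of mulr_suml raddf_sum; apply: eq_bigr => j _ /=.
by rewrite Mmat_entry -scalerAl mcoeffZ mulrC; congr (_ * _@_ _); apply: mulrC.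
Qed.

Hypothesis f_hom : f \is e.-homog.

(** The rows list exactly the monomials of degree [e + t] outside the ideal of powers, so the matrix
    is multiplication by [f] from forms of degree [t] into the quotient. *)
Lemma Mmat_kernel t (y : 'cV[k]_#|{: expT n t}|) : Mmat e t m f *m y = 0 <-> in_colon m f (poly_of y).
Proof.
split=> [My0 | /in_powers_idealP h]; last first.
  apply/colP => i; rewrite Mmat_mul mxE h // => l; rewrite mnmE; exact: ltn_ord.
apply/in_powers_idealP => u lt_u.
have [ut | ne] := eqVneq (mdeg u) (t + e)%N; last first.
  by apply: dhomog_nemf_coeff ne; apply: dhomogM (poly_of_homog y) f_hom.
pose g := [ffun i => Ordinal (lt_u i)].
have g_deg : (\sum_(i < n) (g i : nat) == e + t)%N.
  by rewrite addnC -ut mdegE; apply/eqP; apply: eq_bigr => i _; rewrite ffunE.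
have := Mmat_mul y (enum_rank (Sub g g_deg : rowT n m (e + t))).
rewrite My0 mxE enum_rankK => ->; congr (_@_ _).
by apply/mnmP => i; rewrite mnmE SubK ffunE.
Qed.

Lemma Mmat_full_rank t : (0 < n)%N -> \rank (Mmat e t m f) = 'C(t + n - 1, n - 1) <->
  (forall p, p \is t.-homog -> in_colon m f p -> p = 0).
Proof.
move=> n_gt0; rewrite -(card_expT t n_gt0).
apply: (iff_trans (rank_eq_ncols _)); split=> [h p hp | h y /Mmat_kernel/h].
  have [y ->] := poly_of_surj hp; move/Mmat_kernel/h ->.
  by rewrite /poly_of big1 // => j _; rewrite mxE scale0r.
move=> /(_ (poly_of_homog y)) y0; apply/colP => j.
by rewrite -[j]enum_valK -mcoeff_poly_of y0 mcoeff0 mxE.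
Qed.

(** Evaluation at the coefficient point is a ring morphism, so it commutes with determinants and
    turns generic minors into minors of [Mmat]. *)
Lemma minors_locus_full_rank t : (0 < n)%N ->
  outside_minors_locus 'C(t + n - 1, n - 1) (MGmat k n e t m)
    (fun i => coef_pt f (enum_val i)) <->
  \rank (Mmat e t m f) = 'C(t + n - 1, n - 1).
Proof.
move=> n_gt0; rewrite -(card_expT t n_gt0).
apply: (iff_trans _ (full_rank_minorP _)).
have evalE : map_mx (meval (fun i => coef_pt f (enum_val i))) (MGmat k n e t m) = Mmat e t m f.
  apply/matrixP => i j; rewrite !mxE /=; case: pickP => [a _ | _]; last exact: meval0.
  by rewrite mevalXU enum_rankK.
split=> -[rs [cs nz]]; exists rs, cs.
  by rewrite -evalE -map_mxsub det_map_mx.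
by rewrite -evalE -map_mxsub det_map_mx in nz.
Qed.

End CoefficientMatrix.

Theorem theorem4p4 (k : fieldType) (n m e : nat) (f : {mpoly k[n]})
  (hn : (2 <= n)%N) (hm : (1 <= m)%N) (hf0 : f != 0) (hfe : f \is e.-homog)
  (hfI : ~ in_powers_ideal m f) :
  let s := (n * (m - 1) - e)%N in
  let Imem := in_colon m f in
  let kk := 'C(s./2 + n - 1, n - 1) in
  let Pf := fun i : 'I_#|{: expT n e}| => coef_pt f (@enum_val _ {: expT n e} i) in
  [/\ (exists d : nat, has_linear_gor_resolution Imem d)
        <-> (~~ odd s /\ \rank (Mmat e s./2 m f) = kk),
      (~~ odd s /\ \rank (Mmat e s./2 m f) = kk)
        <-> (~~ odd s /\ outside_minors_locus kk (MGmat k n e s./2 m) Pf)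
    & (exists d : nat, has_linear_gor_resolution Imem d) ->
        generated_in_degree Imem (s./2).+1].
Proof.
move=> s Imem kk Pf; have n_gt0 : (0 < n)%N by exact: ltnW.
pose lam : {scalar {mpoly k[n]}} := socle_form m f.
have IE p : annih lam p <-> Imem p := annih_socle_form f hm p.
have lam_s a p : shomog a p -> a <> s.+1 -> lam p = 0.
  by rewrite /s subn1; apply: (socle_form_degree hm hfe hfI).
have lam_nz : exists p, lam p != 0 by apply: (socle_form_neq0 hm hfI).
have inv d : has_linear_gor_resolution Imem d -> [/\ ~~ odd s, d = (s./2).+1,
    forall p, p \is s./2.-homog -> Imem p -> p = 0 & generated_in_degree Imem d].
  move=> res; have {}res : has_linear_gor_resolution (annih lam) d.
    by apply: has_linear_gor_resolution_ext res => p; split=> /IE.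
  have [d_gt0 sE low [r [g [hg gen]]]] := linear_resolution_inv lam_s lam_nz hn res.
  have dE : d = (s./2).+1 by rewrite sE doubleK prednK.
  split=> //; first by rewrite sE odd_double.
    by move=> p /shomogE; rewrite -dE => hp /IE; apply: low.
  exists r, g; split=> // p; split=> [/IE/gen // | /gen/IE //].
split.
- split=> [[d /inv[ev _ low _]] | [ev /(Mmat_full_rank _ hfe _ n_gt0) low]].
    by split=> //; apply/(Mmat_full_rank _ hfe).
  exists (s./2).+1; apply: (has_linear_gor_resolution_ext IE).
  apply: (linear_resolution lam_s lam_nz hn).
    by rewrite -[LHS]odd_double_half (negPf ev).
  move=> [|d] p le_d hp /IE p_I; first exact: shomog_eq0 hp.
  have i : 'I_n by exists 0%N.
  (* The rank condition concerns degree [s./2] alone. A form of I of lower degree is lifted there by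
     a power of a variable, and [R] is a domain. *)
  have : p * 'X_i ^+ (s./2 - d) = 0.
    apply: low; last by rewrite /Imem /in_colon mulrAC; apply: in_powers_idealM.
    rewrite -{2}(subnKC (_ : d <= s./2)%N) //; apply: dhomogM; first exact/shomogE.
    have X_hom : ('X_i : {mpoly k[n]}) \is 1.-homog by rewrite dhomogX /= mdeg1.
    by have := dhomogMn (s./2 - d) X_hom; rewrite mul1n.
  move/eqP; rewrite mulf_eq0 => /orP[/eqP // | ].
  by rewrite expf_eq0 (negPf (mpolyX_neq0 _ _)) andbF.
- by split=> -[ev h]; split=> //; apply/(minors_locus_full_rank _ _ f _ n_gt0).
by case=> d /inv[_ <- _].
Qed.
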